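(* Let $R$ be a prime (respectively, semiprime) left Goldie ring, let $\mathbb S=R[X;\boldsymbol\alpha,\boldsymbol\delta]$ be a skew polynomial ring of bijective type over a well-ordered set of variables, and let $A$ be an essentially special subextension of $\mathbb S$. Then $A$ is left Goldie and $\operatorname{udim}(A)=\operatorname{udim}(R)$. If moreover $A$ is a strongly essentially special subextension of $\mathbb S$, then $A$ is prime (respectively, semiprime).
   Context: Setting (M): $R$ a ring, $\Omega$ an ordinal, $X=\{x_s:s<\Omega\}$; $T_\kappa$ the standard terms $x_{s_1}\cdots x_{s_n}$ ($s_1\le\cdots\le s_n<\kappa$); $\mathbb S$ has subrings $\mathbb S_\kappa$ ($\kappa\le\Omega$) with $\mathbb S_0=R$, $\mathbb S_\Omega=\mathbb S$, $\mathbb S_\kappa$ free as left $R$-module on $T_\kappa$, $\mathbb S_{\kappa+1}=\mathbb S_\kappa[x_\kappa;\alpha_\kappa,\delta_\kappa]$ an Ore extension with $\alpha_\kappa$ an automorphism and $\delta_\kappa$ an $\alpha_\kappa$-derivation, and $\mathbb S_\kappa=\bigcup_{\eta<\kappa}\mathbb S_\eta$ for limit $\kappa$. Univariate notions (for a ring $S\supseteq R$ free as left $R$-module and an Ore extension $S[x;\alpha,\delta]$): $\operatorname{Deg}_x(A)=\{\deg_xf:0\ne f\in A\}$, $d_A=\gcd(\operatorname{Deg}_x(A)\setminus\{0\})$ if $A\not\subseteq S$, else $0$. A subring $A\supseteq R$ is a special subextension if $A=\sum_m(A\cap Sx^m)$, $\operatorname{Deg}_x(A)=d_A\mathbb N$,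 and for each $0\ne m\in\operatorname{Deg}_x(A)$ there exist $\lambda_m=\upsilon_mx^m\in A$ with $\upsilon_m$ regular in $S$, a subring $B_m$ with $R\subseteq B_m\subseteq A\cap S$ and an automorphism $\alpha_{(m)}$ of $B_m$ with $\deg_x(\lambda_mp-\alpha_{(m)}(p)\lambda_m)<m$ for $p\in B_m$, and for every $q\in S$ with $qx^m\in A$ some $u\in B_m$ regular in $S$ with $uqx^m\in B_m\lambda_m$; for $m=0$: $\lambda_0=1$, $B_0=A\cap S$. A subring $A$ of a ring $B$ is nicely essential if for every finite set $E\subseteq B$ of non-zero elements there is $a\in A$ with $0\ne ax\in A$ for all $x\in E$; strongly nicely essential if moreover for every $x\in B$ there is $c\in A$ with $\{a\in A:ac=0\}=0$ and $cx\in A$. (Strongly) essentially special subextension of $\mathbb S$, by induction on $\Omega$: if $\Omega=0$, a (strongly) nicely essential subring of $R$; if $\Omega$ is a limit ordinal, an increasing union $A=\bigcup_{\kappa\in\Lambda}A_\kappa$, $\Lambda\subseteq\Omega$, with each $A_\kappa$ a (strongly) essentially special subextension of $\mathbb S_\kappa$; if $\Omega=\kappa+1$, a (strongly) nicely essential subring of some special subextension $\widetilde A$ of $\mathbb S_\kappa[x_\kappa;\alpha_\kappa,\delta_\kappa]$ such that every attached ring $B_m$ ($m\in\operatorname{Deg}_{x_\kappa}(\widetilde A)$) is a (strongly) essentially special subextension of $\mathbb S_\kappa$. Left Goldie: finite left uniform dimension and ACC on left annihilators. *)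

(* Defs.v *)
(* All rings/subrings are predicates (Prop) on an ambient
   ring S : nzRingType (the skew polynomial ring), so R, S_kappa, A, B_m are
   all subsets of S. *)
From HB Require Import structures.
From Stdlib Require Lists.List.
From mathcomp Require Import all_boot all_order all_algebra.
Set Implicit Arguments.
Unset Strict Implicit.
Unset Printing Implicit Defensive.
Import GRing.Theory.
Local Open Scope ring_scope.

Section Defs.
Variable S : nzRingType.

Definition subset_of (A B : S -> Prop) : Prop := forall a, A a -> B a.

Definition subring (A : S -> Prop) : Prop :=
  [/\ A 1, forall a b, A a -> A b -> A (a - b) & forall a b, A a -> A b -> A (a * b)].

Definition regular_in (T : S -> Prop) (u : S) : Prop :=
  forall s, T s -> (s * u = 0 -> s = 0) /\ (u * s = 0 -> s = 0).

Definition automorphism_on (B : S -> Prop) (phi : S -> S) : Prop :=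
  (forall p, B p -> B (phi p)) /\
  (forall p q, B p -> B q -> phi (p + q) = phi p + phi q) /\
  (forall p q, B p -> B q -> phi (p * q) = phi p * phi q) /\
  phi 1 = 1 /\
  (forall p q, B p -> B q -> phi p = phi q -> p = q) /\
  (forall q, B q -> exists2 p, B p & phi p = q).

Definition derivation_on (B : S -> Prop) (alpha d : S -> S) : Prop :=
  [/\ forall p, B p -> B (d p),
      forall p q, B p -> B q -> d (p + q) = d p + d q &
      forall p q, B p -> B q -> d (p * q) = alpha p * d q + d p * q].

Definition nicely_essential (strong : bool) (A B : S -> Prop) : Prop :=
  [/\ subring A, subset_of A B,
      (forall E : seq S, (forall e, e \in E -> B e /\ e != 0) ->
         exists2 a, A a & forall e, e \in E -> a * e != 0 /\ A (a * e)) &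
      (strong -> forall y, B y ->
         exists2 c, A c & (forall a, A a -> a * c = 0 -> a = 0) /\ A (c * y))].

Definition left_ideal (A L : S -> Prop) : Prop :=
  [/\ subset_of L A, L 0, forall a b, L a -> L b -> L (a + b)
    & forall r a, A r -> L a -> L (r * a)].

Definition indep_nonzero_left_ideals (A : S -> Prop) (n : nat)
    (L : 'I_n -> S -> Prop) : Prop :=
  [/\ forall k, left_ideal A (L k),
      forall k, exists2 l, L k l & l != 0 &
      forall v : 'I_n -> S, (forall k, L k (v k)) ->
        \sum_(k < n) v k = 0 -> forall k, v k = 0].

Definition udim (A : S -> Prop) (n : nat) : Prop :=
  (exists L : 'I_n -> S -> Prop, indep_nonzero_left_ideals A L) /\
  ~ (exists L : 'I_n.+1 -> S -> Prop, indep_nonzero_left_ideals A L).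

Definition left_ann (A X : S -> Prop) : S -> Prop :=
  fun a => A a /\ forall y, X y -> a * y = 0.

Definition acc_left_ann (A : S -> Prop) : Prop :=
  forall X : nat -> S -> Prop, (forall n, subset_of (X n) A) ->
    (forall n, subset_of (left_ann A (X n)) (left_ann A (X n.+1))) ->
    exists N, forall n, (N <= n)%N ->
      forall a, left_ann A (X n) a <-> left_ann A (X N) a.

Definition left_goldie (A : S -> Prop) : Prop :=
  (exists n, udim A n) /\ acc_left_ann A.

Definition prime_ring (A : S -> Prop) : Prop :=
  forall a b, A a -> A b -> (forall r, A r -> a * r * b = 0) -> a = 0 \/ b = 0.

Definition semiprime_ring (A : S -> Prop) : Prop :=
  forall a, A a -> (forall r, A r -> a * r * a = 0) -> a = 0.

Section Univariate.
Variables (S' : S -> Prop) (y : S).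

Definition deg_lt (f : S) (m : nat) : Prop :=
  exists c : nat -> S, (forall k, S' (c k)) /\ f = \sum_(k < m) c k * y ^+ k.

Definition deg_eq (f : S) (n : nat) : Prop :=
  exists c : nat -> S, [/\ forall k, S' (c k), c n != 0 &
                          f = \sum_(k < n.+1) c k * y ^+ k].

Definition Deg (A : S -> Prop) (n : nat) : Prop :=
  exists f, [/\ A f, f != 0 & deg_eq f n].

(* d is the gcd of the set P \ {0} (for the divisibility order on nat);
   the gcd of the empty set is 0 *)
Definition is_gcd_set (P : nat -> Prop) (d : nat) : Prop :=
  (forall n, P n -> n != 0%N -> (d %| n)%N) /\
  (forall e, (forall n, P n -> n != 0%N -> (e %| n)%N) -> (e %| d)%N).

(* A is a special subextension of the Ore extension T = S'[y; alpha, delta],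
   with attached rings B m (m in Deg_y(A)). *)
Definition special_subext (T A : S -> Prop) (B : nat -> S -> Prop) : Prop :=
  subring A /\ subset_of A T /\ subset_of S' T /\
      (* R <= A is required separately (in [ess]) *)
      (forall a, A a -> exists (n : nat) (c : nat -> S),
          (forall k, S' (c k) /\ A (c k * y ^+ k)) /\
          a = \sum_(k < n) c k * y ^+ k) /\
      (exists d, is_gcd_set (Deg A) d /\
                 forall n, Deg A n <-> exists k, n = (d * k)%N) /\
      (forall p, B 0%N p <-> A p /\ S' p) /\
      (forall m, Deg A m -> m != 0%N ->
        exists (ups : S) (alpha_m : S -> S),
        S' ups /\ regular_in S' ups /\ A (ups * y ^+ m) /\
            subring (B m) /\ subset_of (B m) (fun p => A p /\ S' p) /\
            automorphism_on (B m) alpha_m /\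
            (forall p, B m p ->
               deg_lt (ups * y ^+ m * p - alpha_m p * (ups * y ^+ m)) m) /\
            (forall q, S' q -> A (q * y ^+ m) ->
               exists u, [/\ B m u, regular_in S' u &
                 exists2 b, B m b & u * q * y ^+ m = b * (ups * y ^+ m)])).
End Univariate.

Section Skew.
Variables (R : S -> Prop) (I : Type) (lt : I -> I -> Prop) (x : I -> S).

Fixpoint nondecr (t : list I) : Prop :=
  match t with
  | a :: ((b :: _) as t') => (lt a b \/ a = b) /\ nondecr t'
  | _ => True
  end.

Definition monom (t : list I) : S := \prod_(s <- t) x s.

Definition all_in (D : I -> Prop) (t : list I) : Prop :=
  forall s, Stdlib.Lists.List.In s t -> D s.

Definition Sk (D : I -> Prop) (f : S) : Prop :=
  exists (n : nat) (t : 'I_n -> list I) (r : 'I_n -> S),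
    [/\ forall k, all_in D (t k), forall k, nondecr (t k), forall k, R (r k) &
        f = \sum_(k < n) r k * monom (t k)].

Definition seg (i : I) : I -> Prop := fun s => lt s i.

Definition well_order : Prop :=
  [/\ forall a, ~ lt a a,
      forall a b c, lt a b -> lt b c -> lt a c,
      forall a b, [\/ lt a b, a = b | lt b a] &
      well_founded lt].

Definition skew_poly_bijective (alpha delta : I -> S -> S) : Prop :=
  [/\ subring R, well_order,
      (forall (n : nat) (t : 'I_n -> list I) (r : 'I_n -> S),
          (forall j k, t j = t k -> j = k) -> (forall k, nondecr (t k)) ->
          (forall k, R (r k)) -> \sum_(k < n) r k * monom (t k) = 0 ->
          forall k, r k = 0),
      (forall f, Sk (fun _ => True) f) &
      (* S_{i+1} = S_i[x_i; alpha_i, delta_i] *)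
      forall i, [/\ automorphism_on (Sk (seg i)) (alpha i),
                    derivation_on (Sk (seg i)) (alpha i) (delta i) &
                    forall p, Sk (seg i) p ->
                      x i * p = alpha i p * x i + delta i p]].

(* (strongly, if [strong]) essentially special subextensions of S_D,
   D an initial segment of I (an ordinal <= Omega) *)
Inductive ess (strong : bool) : (I -> Prop) -> (S -> Prop) -> Prop :=
  | ess_zero (D : I -> Prop) (A : S -> Prop) :
      (forall s, ~ D s) -> nicely_essential strong A R -> ess strong D A
  | ess_limit (D : I -> Prop) (A : S -> Prop)
      (Lam : I -> Prop) (Af : I -> S -> Prop) :
      (exists s, D s) -> (forall s, D s -> exists2 s', D s' & lt s s') ->
      (forall i, Lam i -> D i) -> (exists i, Lam i) ->
      (forall i j, Lam i -> Lam j -> lt i j -> subset_of (Af i) (Af j)) ->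
      (forall i, Lam i -> ess strong (seg i) (Af i)) ->
      (forall a, A a <-> exists2 i, Lam i & Af i a) ->
      ess strong D A
  | ess_succ (D : I -> Prop) (A : S -> Prop) (i : I)
      (At : S -> Prop) (B : nat -> S -> Prop) :
      D i -> (forall s, D s -> s = i \/ lt s i) ->
      special_subext (Sk (seg i)) (x i) (Sk D) At B -> subset_of R At ->
      subset_of R (B 0%N) ->
      (forall m, Deg (Sk (seg i)) (x i) At m -> m != 0%N -> subset_of R (B m)) ->
      (forall m, Deg (Sk (seg i)) (x i) At m -> ess strong (seg i) (B m)) ->
      nicely_essential strong A At ->
      ess strong D A.

End Skew.
End Defs.

(* Main.v *)
Require Import Defs.
From mathcomp Require Import all_boot all_order all_algebra.
From mathcomp Require Import boolp zify.
Set Implicit Arguments.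
Unset Strict Implicit.
Unset Printing Implicit Defensive.
Import GRing.Theory.
Local Open Scope ring_scope.

(** Let [n] be the left uniform dimension of [R].  Three facts are carried along
    the construction of an essentially special subextension [A]: it contains [n]
    independent elements (multiples of independent elements of [R], which stay
    independent over the whole skew polynomial ring), it contains no [n + 1]
    independent elements, and [n] independent elements of [A] never kill a nonzero
    element of [A] on the left.  All three survive unions of chains and nicely
    essential subrings.  For a special subextension the last two come from
    counting: over [B_0], the part of [A] in degrees below [d J] has uniform
    dimension at most [n J], whereas a nonzero left ideal contributes about [J]
    independent leading terms.  The three facts imply that left annihilators are
    closed, hence ACC on them.

    If [A] is strongly nicely essential in [B], then [a A b = 0] forces
    [a B b = 0]: with [M] the left annihilator of [A b] and [c] left regular such
    that [c y] lies in [A], the left ideal [M c] is essential in [M] and is killed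
    by [y b].  For a special subextension, (semi)primeness is read off leading
    terms [b lambda_m]: [f A g = 0] gives [b B_m alpha_(m)^k(b') = 0] for [k > 0],
    and in the semiprime case the elements [alpha_(m)^k(b)] would otherwise be
    infinitely many orthogonal, hence independent, elements. *)

(** * Independent families over a subring, exchange, and bounds on uniform dimension *)

Section Independence.
Variable S : nzRingType.
Implicit Types (A B U V W : S -> Prop) (F : finType).

Lemma subring1 B : subring B -> B 1.
Proof. by case. Qed.

Lemma subringB B a b : subring B -> B a -> B b -> B (a - b).
Proof. by case=> _ h _; apply: h. Qed.

Lemma subringM B a b : subring B -> B a -> B b -> B (a * b).
Proof. by case=> _ _; apply. Qed.

Lemma subring0 B : subring B -> B 0.
Proof. by move=> hB; rewrite -(subrr 1); apply: subringB => //; apply: subring1. Qed.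

Lemma subringN B a : subring B -> B a -> B (- a).
Proof. by move=> hB ha; rewrite -sub0r; apply: subringB => //; apply: subring0. Qed.

Lemma subringD B a b : subring B -> B a -> B b -> B (a + b).
Proof. by move=> hB ha hb; rewrite -[b]opprK; apply: subringB => //; apply: subringN. Qed.

Definition submod B V : Prop :=
  [/\ V 0, forall a b, V a -> V b -> V (a + b) & forall r a, B r -> V a -> V (r * a)].

Lemma submod_sum B V F (P : pred F) (f : F -> S) :
  submod B V -> (forall i, P i -> V (f i)) -> V (\sum_(i | P i) f i).
Proof. by case=> h0 hD _ hf; elim/big_ind: _. Qed.

Lemma submodN B V a : subring B -> submod B V -> V a -> V (- a).
Proof.
move=> hB [_ _ hM] ha; rewrite -mulN1r; apply: hM => //.
by apply: subringN => //; apply: subring1.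
Qed.

Lemma submodB B V a b : subring B -> submod B V -> V a -> V b -> V (a - b).
Proof.
by move=> hB hV ha hb; case: (hV) => _ hD _; apply: hD => //; apply: submodN hB hV hb.
Qed.

Lemma subring_submod B : subring B -> submod B B.
Proof.
by move=> hB; split=> [|a b ? ?|a b ? ?]; [apply: subring0|apply: subringD|apply: subringM].
Qed.

Lemma submod_sub A B V : subset_of B A -> submod A V -> submod B V.
Proof. by move=> h [h0 hD hM]; split=> // r a /h; apply: hM. Qed.

Lemma submodI B U V : submod B U -> submod B V -> submod B (fun f => U f /\ V f).
Proof.
move=> [u0 uD uM] [v0 vD vM]; split=> // [a b|r a].
  by case=> ? ? [? ?]; split; [apply: uD|apply: vD].
by move=> hr [? ?]; split; [apply: uM|apply: vM].
Qed.

(** The left [B]-modules generated by the [v i] are nonzero and their sum is direct. The conclusion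
    is [a i * v i = 0] and not [a i = 0], because the [v i] may have nonzero annihilators. *)
Definition indep B F (T : {set F}) (v : F -> S) : Prop :=
  (forall i, i \in T -> v i != 0) /\
  (forall a : F -> S, (forall i, i \in T -> B (a i)) ->
     \sum_(i in T) a i * v i = 0 -> forall i, i \in T -> a i * v i = 0).

(** An arbitrary finite index type lets subfamilies, families with one more member (over [option F])
    and doubly indexed families be compared without renumbering. *)
Definition udim_le B V (k : nat) : Prop :=
  forall F (T : {set F}) (v : F -> S),
    (forall i, i \in T -> V (v i)) -> indep B T v -> (#|T| <= k)%N.

Lemma indep_sub A B F (T : {set F}) v : subset_of A B -> indep B T v -> indep A T v.
Proof. by move=> AB [nz h]; split=> // a ha; apply: h => i /ha/AB. Qed.

Lemma indep_subset B F (T T' : {set F}) v :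
  subring B -> T' \subset T -> indep B T v -> indep B T' v.
Proof.
move=> hB /subsetP sTT [nz h]; split=> [i /sTT/nz//|a ha s0 i iT'].
have := h (fun i => if i \in T' then a i else 0).
rewrite (bigID (mem T')) /= [X in _ + X]big1 ?addr0; last first.
  by move=> j /andP[_ /negPf->]; rewrite mul0r.
rewrite (eq_bigl (mem T')) /=; last first.
  by move=> j; apply/andP/idP => [[]//|jT']; split=> //; apply: sTT.
under eq_bigr => j -> do [].
move=> /(_ _ s0 i (sTT _ iT')); rewrite iT'; apply=> j _.
by case: ifP => [/ha//|_]; apply: subring0.
Qed.

Lemma indep_scale B F (T : {set F}) v s :
  subring B -> indep B T v -> (forall i, i \in T -> B (s i)) ->
  (forall i, i \in T -> s i * v i != 0) -> indep B T (fun i => s i * v i).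
Proof.
move=> hB [_ h] hs nz; split=> // a ha s0 i iT; rewrite mulrA.
apply: (h (fun i => a i * s i)) => // [j jT|].
  by apply: subringM; [|apply: ha|apply: hs].
by rewrite -[RHS]s0; apply: eq_bigr => j _; rewrite mulrA.
Qed.

Lemma indep_eq B F (T : {set F}) v w :
  {in T, v =1 w} -> indep B T v -> indep B T w.
Proof.
move=> e [nz h]; split=> [i iT|a ha s0 i iT]; first by rewrite -e // nz.
rewrite -e //; apply: h => //; rewrite -[RHS]s0.
by apply: eq_bigr => j jT; rewrite e.
Qed.

(** Once the multiple of [g] in a relation vanishes, the rest is a relation among the [v i]. So [g]
    can be adjoined, and the enlarged family is still bounded by [k]. *)
Lemma indep_extend B V k F (T : {set F}) v g :
  subring B -> udim_le B V k -> indep B T v ->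
  (forall i, i \in T -> V (v i)) -> V g -> g != 0 ->
  (forall s a, B s -> (forall i, i \in T -> B (a i)) ->
     s * g + \sum_(i in T) a i * v i = 0 -> s * g = 0) -> (#|T| < k)%N.
Proof.
move=> hB hle [nz hT] hv hg gnz hs.
pose w (o : option F) := if o is Some i then v i else g.
pose T' := None |: (Some @: T).
have NT : None \notin Some @: T by apply/imsetP => -[].
have -> : #|T|.+1 = #|T'| by rewrite cardsU1 NT card_imset // => ? ? [].
have inT i : (Some i \in T') = (i \in T).
  by rewrite !inE /=; apply/imsetP/idP => [[j ? [->]]|?] //; exists i.
apply: (hle _ T' w) => [[i|] //|]; first by rewrite inT; apply: hv.
split=> [[i|] //|a ha]; first by rewrite inT; apply: nz.
rewrite big_setU1 // big_imset /=; last by move=> ? ? _ _ [].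
move=> s0.
have aT i : i \in T -> B (a (Some i)) by move=> iT; apply: ha; rewrite inT.
have g0 : a None * g = 0.
  by apply: (hs _ (fun i => a (Some i))) => //; apply: ha; rewrite !inE.
move=> [i|] //=; rewrite inT => iT; apply: (hT (fun i => a (Some i))) => //.
by rewrite -[RHS]s0 g0 add0r.
Qed.

(* The relation of minimal support makes the exchange work: if [b] kills one of
   its terms, then [b] kills the whole relation. *)
Lemma indep_exchange B U F (T P : {set F}) v :
  subring B -> submod B U -> P \subset T -> indep B T v ->
  (exists a : F -> S, [/\ forall i, i \in T :\: P -> B (a i),
     U (\sum_(i in T :\: P) a i * v i) & \sum_(i in T :\: P) a i * v i != 0]) ->
  exists j a, let y := \sum_(i in T :\: P) a i * v i in
    [/\ j \in T :\: P, forall i, i \in T :\: P -> B (a i), U y &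
        indep B T (fun i => if i == j then y else v i)].
Proof.
move=> hB hU PT ind exa.
set Q := T :\: P.
have QT : Q \subset T by apply: subsetDl.
pose supp (a : F -> S) := [set i in Q | a i * v i != 0].
pose ok a := [/\ forall i, i \in Q -> B (a i), U (\sum_(i in Q) a i * v i)
  & \sum_(i in Q) a i * v i != 0].
have exm : exists m, `[< exists a, ok a /\ #|supp a| = m >].
  by case: exa => a oka; exists #|supp a|; apply/asboolP; exists a.
case: (ex_minnP exm) => m /asboolP[a [[aB aU anz] am]] mmin.
have [j jQ jnz] : exists2 j, j \in Q & a j * v j != 0.
  apply: contrapT => hn; case/eqP: anz; apply: big1 => i iQ.
  by apply/eqP/negP => /negP ?; apply: hn; exists i.
have jT : j \in T := subsetP QT _ jQ.
exists j, a => /=; set y := \sum_(i in Q) a i * v i.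
split=> //; case: (ind) => nz h.
have indQ := indep_subset hB QT ind.
split=> [i iT|b hb]; first by case: ifP => _; [|apply: nz].
rewrite (bigD1 j) //= eqxx => s0.
have hbj := hb _ jT.
(* Expanding [y] turns the relation into one among the [v i]; its coefficient at [j] is
   [b j * a j]. *)
pose c i := (if i \in Q then b j * a i else 0) + (if i == j then 0 else b i).
have hc i : i \in T -> B (c i).
  move=> iT; apply: subringD => //; case: ifP => [iQ|_]; try exact: subring0.
    by apply: subringM => //; apply: aB.
  exact: hb.
have sQ : \sum_(i in T) (if i \in Q then b j * a i else 0) * v i = b j * y.
  rewrite (bigID (mem Q)) /= [X in _ + X]big1 ?addr0; last first.
    by move=> i /andP[_ /negPf->]; rewrite mul0r.
  rewrite (eq_bigl (mem Q)) /=; last first.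
    by move=> i; apply/andP/idP => [[]//|iQ]; split=> //; apply: (subsetP QT).
  by rewrite mulr_sumr; apply: eq_bigr => i ->; rewrite mulrA.
have hcs : \sum_(i in T) c i * v i = 0.
  under eq_bigr do rewrite mulrDl.
  rewrite big_split /= sQ -[RHS]s0; congr (_ + _).
  rewrite (bigD1 j) //= eqxx mul0r add0r.
  by apply: eq_bigr => i /andP[_ /negPf->].
have hc0 := h _ hc hcs.
have bjj : b j * (a j * v j) = 0.
  by have := hc0 _ jT; rewrite /c jQ eqxx addr0 mulrA.
have by0 : b j * y = 0.
  apply/eqP/negP => /negP bnz.
  have e : \sum_(i in Q) (b j * a i) * v i = b j * y.
    by rewrite mulr_sumr; apply: eq_bigr => i _; rewrite mulrA.
  pose ba i := b j * a i.
  suff lt : (#|supp ba| < m)%N.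
    suff : (m <= #|supp ba|)%N by rewrite leqNgt lt.
    apply: mmin; apply/asboolP; exists ba; split=> //; split=> [i iQ||].
    - by apply: subringM => //; apply: aB.
    - by rewrite e; case: hU => _ _; apply.
    - by rewrite e.
  rewrite -am; apply: proper_card; apply/properP; split.
    apply/subsetP => i; rewrite !in_set => /andP[-> /=]; apply: contra => /eqP.
    by rewrite /ba -mulrA => ->; rewrite mulr0.
  by exists j; rewrite in_set jQ //= /ba -mulrA bjj eqxx.
have bay i : i \in Q -> b j * a i * v i = 0.
  case: indQ => _ hQ iQ; apply: (hQ (fun i => b j * a i)) => // [k kQ|].
    by apply: subringM => //; apply: aB.
  by rewrite -[RHS]by0 mulr_sumr; apply: eq_bigr => k _; rewrite mulrA.
move=> i iT; case: eqP => [->//|/eqP/negPf ij].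
have := hc0 _ iT; rewrite /c ij mulrDl; case: ifP => [/bay->|_].
  by rewrite add0r.
by rewrite mul0r add0r.
Qed.

(** Subadditivity on an extension, with [W] standing for the quotient of [V] by its part in [U].
    Members of the family are exchanged for elements of [U] as long as possible; the remaining ones
    have no nonzero combination in [U], so their counterparts in [W] are still independent. *)
Lemma udim_le_ext B U V W k l :
  subring B -> submod B U -> submod B V -> submod B W ->
  (forall v, V v -> exists2 w, W w & U (v - w)) ->
  (forall w, U w -> W w -> w = 0) ->
  udim_le B (fun f => V f /\ U f) k -> udim_le B W l -> udim_le B V (k + l).
Proof.
move=> hB hU hV hW hVW hUW hk hl F T v hv ind.
(* [P] collects the members already moved into [U]; the induction is on the number of the others. *)
suff H : forall q (P : {set F}) v, P \subset T -> #|T :\: P| = q -> indep B T v ->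
    (forall i, i \in T -> V (v i)) -> (forall i, i \in P -> U (v i)) ->
    (#|T| <= k + l)%N.
  by apply: (H _ set0 v) => // [|i]; rewrite ?sub0set // inE.
move=> {v hv ind}; elim=> [|q IH] P v PT cQ ind hv hP.
  have TP : T \subset P by rewrite -setD_eq0 -cards_eq0 cQ.
  apply: (leq_trans _ (leq_addr _ _)); apply: (hk _ T v) => // i iT.
  by split; [apply: hv|apply/hP/(subsetP TP)].
set Q := T :\: P in cQ.
have QT : Q \subset T by apply: subsetDl.
case: (pselect (exists a : F -> S, [/\ forall i, i \in Q -> B (a i),
     U (\sum_(i in Q) a i * v i) & \sum_(i in Q) a i * v i != 0])) => [exa|nex].
  have [j [a [jQ aB Uy ind']]] := indep_exchange hB hU PT ind exa.
  have jT : j \in T := subsetP QT _ jQ.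
  apply: (IH (j |: P) _ _ _ ind').
  - by rewrite subUset sub1set jT.
  - have -> : T :\: (j |: P) = Q :\ j by apply/setP => i; rewrite !inE negb_or andbA.
    by move: cQ; rewrite (cardsD1 j) jQ => -[].
  - move=> i iT; case: ifP => _; last exact: hv.
    apply: (submod_sum hV) => h hQ; case: hV => _ _; apply; first exact: aB.
    exact/hv/(subsetP QT).
  - move=> i; case: eqP => [->//|/eqP/negPf ij]; rewrite inE inE ij /=.
    exact: hP.
have {nex} hQ a : (forall i, i \in Q -> B (a i)) -> U (\sum_(i in Q) a i * v i) ->
    forall i, i \in Q -> a i * v i = 0.
  move=> aB aU; have [_] := indep_subset hB QT ind; apply=> //.
  by apply/eqP/negP => /negP ?; apply: nex; exists a.
have hw i : exists w, i \in Q -> W w /\ U (v i - w).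
  case: (boolP (i \in Q)) => [iQ|_]; last by exists 0.
  by have [w ? ?] := hVW _ (hv _ (subsetP QT _ iQ)); exists w.
have [w {}hw] := choice hw.
rewrite -(cardsID P T) (setIidPr PT); apply: leq_add.
  apply: (hk _ P v); last exact: indep_subset ind.
  by move=> i iP; split; [apply/hv/(subsetP PT)|apply: hP].
(* If [w i] were zero, [v i] itself would lie in [U], and the choice of [Q] excludes this. *)
apply: (hl _ _ w) => [i /hw[]//|]; split=> [i iQ|a aB s0].
  apply/eqP => w0; have [_] := hw _ iQ; rewrite w0 subr0 => Uv.
  have := hQ (fun j => if j == i then 1 else 0) _ _ _ iQ.
  rewrite eqxx mul1r => H; have [nz _] := ind.
  move: (nz i (subsetP QT _ iQ)); rewrite H ?eqxx // => [j _|].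
    by case: ifP => _; [apply: subring1|apply: subring0].
  rewrite (bigD1 i) //= eqxx mul1r big1 ?addr0 // => j /andP[_ /negPf->].
  by rewrite mul0r.
have UM : forall r a, B r -> U a -> U (r * a) by case: hU.
have av0 : forall i, i \in Q -> a i * v i = 0.
  apply: hQ => //.
  have -> : \sum_(i in Q) a i * v i = \sum_(i in Q) a i * (v i - w i).
    by under [RHS]eq_bigr do rewrite mulrBr; rewrite sumrB s0 subr0.
  apply: (submod_sum hU) => i iQ; apply: UM; first exact: aB.
  by have [] := hw _ iQ.
move=> i iQ; have [Ww Uvw] := hw _ iQ; apply: hUW; last first.
  by case: hW => _ _; apply=> //; apply: aB.
rewrite -[a i * w i]opprK; apply: (submodN hB hU).
rewrite -[X in U X]add0r -(av0 _ iQ) -mulrBr; apply: UM => //; exact: aB.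
Qed.

Lemma udim_le_eq B V V' k :
  (forall f, V' f -> V f) -> udim_le B V k -> udim_le B V' k.
Proof. by move=> e h F T v hv; apply: h => i /hv/e. Qed.

End Independence.

(** * Nonsingular rings of finite uniform dimension, the Goldie property, and nicely essential
    subrings *)

Section Goldie.
Variable S : nzRingType.
Implicit Types (A B U V W : S -> Prop) (F : finType).

Definition udim_ge A (n : nat) : Prop :=
  exists2 v : 'I_n -> S, forall i, A (v i) & indep A [set: 'I_n] v.

(* Left nonsingularity of a ring of left uniform dimension [n]: there, the
   essential left ideals are those containing [n] independent elements. *)
Definition nonsingular (n : nat) A : Prop :=
  forall F (T : {set F}) (v : F -> S) a,
    indep A T v -> (forall i, i \in T -> A (v i)) -> (n <= #|T|)%N ->
    A a -> (forall i, i \in T -> v i * a = 0) -> a = 0.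

Definition ns_udim (n : nat) A : Prop :=
  [/\ subring A, udim_ge A n, udim_le A A n & nonsingular n A].

(** The left ideal [B g] witnesses that the left annihilator of [q] is not essential; [q] may lie
    outside [B], and [b] replaces [u * q]. If every [v i * u] had a nonzero multiple [s i * v i * u]
    killed by [q], the [n] independent elements [s i * v i] would kill [b], against
    nonsingularity. *)
Lemma ann_not_essential n B q u b :
  subring B -> udim_ge B n -> nonsingular n B -> B u -> B b -> b != 0 ->
  (forall s, B s -> s * u = 0 -> s = 0) ->
  (forall s, B s -> s * u * q = 0 -> s * b = 0) ->
  exists g, [/\ B g, g != 0 & forall s, B s -> s * g * q = 0 -> s * g = 0].
Proof.
move=> hB [v vB indv] hns uB bB bnz hu hq; apply: contrapT => hn.
have {}hn g : B g -> g != 0 -> exists s, [/\ B s, s * g != 0 & s * g * q = 0].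
  move=> gB gnz; apply: contrapT => hs; apply: hn; exists g; split=> // s sB sq0.
  by apply/eqP/negP => /negP snz; apply: hs; exists s.
have [vnz _] := indv.
have hs i : exists s, [/\ B s, s * (v i * u) != 0 & s * (v i * u) * q = 0].
  apply: hn; first exact: subringM.
  by apply: contraNneq (vnz i (in_setT _)) => /hu->.
have [s {}hs] := choice hs.
case/eqP: bnz; apply: (hns _ [set: 'I_n] (fun i => s i * v i)) => //.
- apply: indep_scale => // i _; first by have [] := hs i.
  by have [_ + _] := hs i; apply: contraNneq; rewrite mulrA => ->; rewrite mul0r.
- by move=> i _; apply: subringM => //; have [] := hs i.
- by rewrite cardsT card_ord.
move=> i _; have [sB _ sq] := hs i; apply: hq; last by rewrite -(mulrA (s i)).
exact: subringM.
Qed.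

Lemma ann_not_essential1 n B q : ns_udim n B -> B q -> q != 0 ->
  exists g, [/\ B g, g != 0 & forall s, B s -> s * g * q = 0 -> s * g = 0].
Proof.
case=> hB hge _ hns qB qnz; have B1 := subring1 hB.
by apply: (ann_not_essential hB hge hns B1 qB qnz) => s _; rewrite mulr1.
Qed.

(** The [v i] lie in the left annihilator of [q], and [B g] meets it trivially. A nonzero [g] could
    therefore be adjoined to a family that already has [n] members. *)
Lemma indep_ann n B F (T : {set F}) v q g :
  ns_udim n B -> indep B T v -> (forall i, i \in T -> B (v i)) -> (n <= #|T|)%N ->
  (forall i, i \in T -> v i * q = 0) -> B g ->
  (forall s, B s -> s * g * q = 0 -> s * g = 0) -> g = 0.
Proof.
move=> [hB _ hle _] ind vB nT vq gB hg; apply/eqP/negP => /negP gnz.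
suff : (#|T| < n)%N by rewrite ltnNge nT.
apply: (indep_extend hB hle ind vB gB gnz) => s a sB aB s0; apply: hg => //.
have /(congr1 (fun z => z * q)) := s0; rewrite mul0r mulrDl mulr_suml.
rewrite [X in _ + X]big1 ?addr0 // => i iT.
by rewrite -mulrA vq // mulr0.
Qed.

(** A relation over [B] is multiplied by one [c] in [A] that brings all nonzero coefficients into
    [A]. The term [a j * v j] is put in [E] as well, so that [c] does not kill it. *)
Lemma nice_indep strong A B F (T : {set F}) v :
  subring B -> nicely_essential strong A B ->
  (forall i, i \in T -> A (v i)) -> indep A T v -> indep B T v.
Proof.
move=> hB [hA AB hE _] vA [nz h]; split=> // a aB s0 j jT.
apply/eqP/negP => /negP jnz.
pose E := a j * v j :: [seq a i | i <- enum T & a i != 0].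
have [|c cA hc] := hE E.
  move=> e; rewrite inE => /predU1P[->|/mapP[i]].
    by split=> //; apply: subringM => //; [apply: aB|apply/AB/vA].
  by rewrite mem_filter mem_enum => /andP[nzi iT] ->; split=> //; apply: aB.
have [] := hc (a j * v j); first by rewrite inE eqxx.
rewrite mulrA => /eqP[]; apply: (h (fun i => c * a i)) => // [i iT|]; last first.
  under eq_bigr do rewrite -mulrA.
  by rewrite -mulr_sumr s0 mulr0.
case: (eqVneq (a i) 0) => [->|nzi]; first by rewrite mulr0; apply: subring0.
apply: (proj2 (hc _ _)); rewrite inE; apply/orP; right; apply/mapP; exists i => //.
by rewrite mem_filter nzi mem_enum.
Qed.

Lemma nice_ns_udim n strong A B :
  ns_udim n B -> udim_ge A n -> nicely_essential strong A B -> ns_udim n A.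
Proof.
move=> [hB _ hle hns] hge hn; have [hA AB _ _] := hn; split=> //.
  move=> F T v vA ind; apply: (hle _ T v) => [i /vA/AB//|].
  exact: nice_indep hn vA ind.
move=> F T v a ind vA nT aA; apply: (hns _ T v) => // [|i /vA/AB//|].
  exact: nice_indep hn vA ind.
exact: AB.
Qed.

(** The last term of a vanishing sum is minus the sum of the earlier ones, hence lies in the
    filtration step that its multiples meet only in zero. *)
Lemma triangular_sum B (w : nat -> S) (L : nat -> S -> Prop) :
  subring B -> (forall k, submod B (L k)) -> (forall k, subset_of (L k) (L k.+1)) ->
  (forall k, L k.+1 (w k)) -> (forall k s, B s -> L k (s * w k) -> s * w k = 0) ->
  forall m a, (forall k, (k < m)%N -> B (a k)) -> \sum_(k < m) a k * w k = 0 ->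
  forall k, (k < m)%N -> a k * w k = 0.
Proof.
move=> hB hL hS hw h; elim=> [//|m IH] a aB; rewrite big_ord_recr /= => s0.
have hS' i j : (i <= j)%N -> subset_of (L i) (L j).
  elim: j => [|j IHj]; first by rewrite leqn0 => /eqP-> y.
  by rewrite leq_eqVlt => /predU1P[-> y //|ij] y /(IHj ij)/hS.
have am : a m * w m = 0.
  apply: h; first exact: aB.
  move/eqP: s0; rewrite addrC addr_eq0 => /eqP->; apply: (submodN hB (hL m)).
  apply: (submod_sum (hL m)) => i _; have [_ _] := hL m; apply.
    by apply: aB; apply: leqW.
  by apply: (hS' i.+1).
move=> k; rewrite ltnS leq_eqVlt => /predU1P[->//|km].
apply: IH => // [i im|]; first by apply: aB; apply: leqW.
by rewrite am addr0 in s0.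
Qed.

Lemma udim_le_seq B V n (w : nat -> S) :
  udim_le B V n -> (forall k, V (w k)) -> (forall k, w k != 0) ->
  ~ (forall m a, (forall k, (k < m)%N -> B (a k)) -> \sum_(k < m) a k * w k = 0 ->
     forall k, (k < m)%N -> a k * w k = 0).
Proof.
move=> hle hV nz h.
suff : (#|[set: 'I_n.+1]| <= n)%N by rewrite cardsT card_ord ltnn.
apply: (hle _ [set: 'I_n.+1] (fun i => w i)) => //; split=> // a aB.
rewrite (eq_bigl xpredT) => [s0 i _|i]; last by rewrite inE.
have := h n.+1 (fun k => a (inord k)) _ _ i (ltn_ord i); rewrite inord_val; apply.
  by move=> k _; apply: aB; rewrite inE.
by rewrite -[RHS]s0; apply: eq_bigr => j _; rewrite inord_val.
Qed.

(* In a nonsingular ring of finite uniform dimension, left annihilators are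
   closed, so a strict ascending chain of them yields independent elements. *)
Lemma ns_udim_acc n A : ns_udim n A -> acc_left_ann A.
Proof.
move=> gA X XA incX; have [hA _ hle _] := gA; apply: contrapT => hn.
have mono i j : (i <= j)%N -> subset_of (left_ann A (X i)) (left_ann A (X j)).
  elim: j => [|j IHj]; first by rewrite leqn0 => /eqP-> y.
  by rewrite leq_eqVlt => /predU1P[-> y //|ij] y /(IHj ij)/incX.
have hX N : submod A (left_ann A (X N)).
  split; first by split=> [|y _]; [apply: subring0|rewrite mul0r].
    move=> a b [aA ha] [bA hb]; split=> [|y Xy]; first exact: subringD.
    by rewrite mulrDl ha ?hb ?addr0.
  move=> r a rA [aA ha]; split=> [|y Xy]; first exact: subringM.
  by rewrite -mulrA ha ?mulr0.
(* [p.1] is a later index; [p.2] is a nonzero element of the annihilator there, whose multiples meet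
   the annihilator of [X N] only in zero. *)
have step N : exists p : nat * S, [/\ (N <= p.1)%N, left_ann A (X p.1) p.2, p.2 != 0
    & forall s, A s -> left_ann A (X N) (s * p.2) -> s * p.2 = 0].
  have [m [Nm [z [zm zN]]]] : exists m, (N <= m)%N /\
      exists z, left_ann A (X m) z /\ ~ left_ann A (X N) z.
    apply: contrapT => hm; apply: hn; exists N => m Nm a; split; last exact: mono.
    by move=> am; apply: contrapT => aN; apply: hm; exists m; split=> //; exists a.
  have [zA _] := zm.
  have [y Xy zy] : exists2 y, X N y & z * y != 0.
    apply: contrapT => hy; apply: zN; split=> // y Xy.
    by apply/eqP/negP => /negP ?; apply: hy; exists y.
  have yA := XA _ _ Xy.
  have [g [gA' gnz hg]] := ann_not_essential1 gA (subringM hA zA yA) zy.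
  (* Since [g] is chosen for [z * y], a multiple [s * g * z] that kills [y] already has
     [s * g = 0]. *)
  exists (m, g * z); split=> //=.
  - by have [_ _] := hX m; apply.
  - apply: contraNneq gnz => gz0.
    by rewrite -[g]mul1r hg ?mul1r ?mulrA ?gz0 ?mul0r //; apply: subring1.
  - move=> s sA [_ /(_ y Xy)]; rewrite -!mulrA [s * _]mulrA => e.
    by rewrite mulrA (hg s sA e) mul0r.
have [f hf] := choice step.
pose N k := iter k (fun N => (f N).1) 0%N.
apply: (@udim_le_seq A A n (fun k => (f (N k)).2) hle).
- by move=> k; have [_ []] := hf (N k).
- by move=> k; have [_ _] := hf (N k).
apply: (triangular_sum (L := fun k => left_ann A (X (N k)))) => // k.
- by apply: mono; have [] := hf (N k).
- by have [] := hf (N k).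
- by have [_ _ _] := hf (N k).
Qed.

(** From independent left ideals, pick a nonzero element in each; from independent elements, take
    the principal left ideals that they generate. *)
Lemma udimP A n : subring A -> udim A n <-> udim_ge A n /\ udim_le A A n.
Proof.
move=> hA; split=> [[[L [Lid Lnz Lind]] hn]|[[v vA [nz ind]] hle]].
  have Lnz' k : exists l, L k l /\ l != 0 by have [l ? ?] := Lnz k; exists l.
  have [v hv] := choice Lnz'; split.
    exists v => [i|]; first by have [/(_ (v i)) + _ _ _] := Lid i; apply; have [] := hv i.
    split=> [i _|a aA]; first by have [] := hv i.
    rewrite (eq_bigl xpredT) => [s0 i _|i]; last by rewrite inE.
    apply: (Lind (fun i => a i * v i)) => // k; have [_ _ _] := Lid k; apply.
      by apply: aA; rewrite inE.
    by have [] := hv k.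
  move=> F T v' v'A ind'; rewrite leqNgt; apply/negP => nT; apply: hn.
  pose h (i : 'I_n.+1) := enum_val (widen_ord nT i).
  have hT i : h i \in T by apply: enum_valP.
  have hinj : injective h.
    by move=> i j /enum_val_inj/(congr1 val)/= ?; apply: val_inj.
  exists (fun k f => exists2 a, A a & f = a * v' (h k)); split.
  - move=> k; split.
    + by move=> _ [a aA ->]; apply: subringM => //; apply: v'A.
    + by exists 0; [apply: subring0|rewrite mul0r].
    + move=> _ _ [a aA ->] [b bA ->]; exists (a + b); last by rewrite mulrDl.
      exact: subringD.
    + move=> r _ rA [a aA ->]; exists (r * a); last by rewrite mulrA.
      exact: subringM.
  - move=> k; exists (v' (h k)); last by have [nz _] := ind'; apply: nz.
    by exists 1; [apply: subring1|rewrite mul1r].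
  - move=> w hw s0 k.
    have hw' i : exists a, A a /\ w i = a * v' (h i) by have [a] := hw i; exists a.
    have [a ha] := choice hw'.
    have hsub : [set h i | i in [set: 'I_n.+1]] \subset T.
      by apply/subsetP => _ /imsetP[i _ ->].
    have [_ hi] := indep_subset hA hsub ind'.
    (* A left inverse of [h], to index the coefficients by [F]; the default [ord0] is only reached
       outside the image of [h]. *)
    pose hm (x : F) := odflt ord0 [pick i | h i == x].
    have hK i : hm (h i) = i.
      by rewrite /hm; case: pickP => [j /eqP/hinj//|/(_ i)]; rewrite eqxx.
    have [_ ->] := ha k; rewrite -{1}(hK k); apply: (hi (fun x => a (hm x))).
    + by move=> _ /imsetP[i _ ->]; rewrite hK; have [] := ha i.
    + rewrite big_imset /=; last by move=> i j _ _ /hinj.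
      rewrite (eq_bigl xpredT) => [|i]; last by rewrite inE.
      by rewrite -[RHS]s0; apply: eq_bigr => i _; rewrite hK; have [_ ->] := ha i.
    + by apply/imsetP; exists k.
split.
  exists (fun k f => exists2 a, A a & f = a * v k); split.
  - move=> k; split.
    + by move=> _ [a aA ->]; apply: subringM.
    + by exists 0; [apply: subring0|rewrite mul0r].
    + move=> _ _ [a aA ->] [b bA ->]; exists (a + b); last by rewrite mulrDl.
      exact: subringD.
    + move=> r _ rA [a aA ->]; exists (r * a); last by rewrite mulrA.
      exact: subringM.
  - move=> k; exists (v k); last by apply: nz; rewrite inE.
    by exists 1; [apply: subring1|rewrite mul1r].
  - move=> w hw s0 k.
    have hw' i : exists a, A a /\ w i = a * v i by have [a] := hw i; exists a.
    have [a ha] := choice hw'.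
    have [_ ->] := ha k; apply: (ind a) => [i _||]; [by have [] := ha i| |exact: in_setT].
    rewrite (eq_bigl xpredT) => [|i]; last by rewrite inE.
    by rewrite -[RHS]s0; apply: eq_bigr => i _; have [_ ->] := ha i.
case=> L [Lid Lnz Lind].
have Lnz' k : exists l, L k l /\ l != 0 by have [l ? ?] := Lnz k; exists l.
have [l hl] := choice Lnz'.
suff : (#|[set: 'I_n.+1]| <= n)%N by rewrite cardsT card_ord ltnn.
apply: (hle _ _ l).
  by move=> i _; have [+ _ _ _] := Lid i; apply; have [] := hl i.
split=> [i _|a aA]; first by have [] := hl i.
rewrite (eq_bigl xpredT) => [s0 i _|i]; last by rewrite inE.
apply: (Lind (fun i => a i * l i)) => // k; have [_ _ _] := Lid k; apply.
  by apply: aA; rewrite inE.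
by have [] := hl k.
Qed.

Lemma ns_udim_goldie n A : ns_udim n A -> left_goldie A /\ udim A n.
Proof.
move=> gA; have [hA hge hle _] := gA.
have u : udim A n by apply/(udimP _ hA).
by split=> //; split; [exists n|apply: ns_udim_acc gA].
Qed.

(** If [A m] met [M c] trivially, the elements [m * c ^+ k] would form an infinite independent
    sequence: a relation among them is a multiple of [m] plus an element of [M c], so the first term
    vanishes, and then a factor [c] cancels from the rest. *)
Lemma essential_mulr n A M c m :
  subring A -> udim_le A A n -> submod A M -> subset_of M A -> A c ->
  (forall m, M m -> M (m * c)) -> (forall r, A r -> r * c = 0 -> r = 0) ->
  M m -> m != 0 ->
  exists s, [/\ A s, s * m != 0 & exists2 m', M m' & s * m = m' * c].
Proof.
move=> hA hle hM MA cA Mc hc mM mnz; apply: contrapT => hn.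
have {}hn s m' : A s -> M m' -> s * m = m' * c -> s * m = 0.
  move=> sA m'M e; apply/eqP/negP => /negP snz; apply: hn; exists s; split=> //.
  by exists m'.
have Mk k : M (m * c ^+ k).
  by elim: k => [|k IH]; rewrite ?mulr1 // exprSr mulrA; apply: Mc.
have MM : forall r a, A r -> M a -> M (r * a) by case: hM.
apply: (@udim_le_seq A A n (fun k => m * c ^+ k) hle) => [k|k|]; first exact/MA/Mk.
  elim: k => [|k]; rewrite ?mulr1 // exprSr mulrA; apply: contraNneq.
  by move/hc => -> //; apply/MA/Mk.
elim=> [//|p IH] a aA; rewrite big_ord_recl /= mulr1.
under eq_bigr do rewrite exprSr !mulrA.
rewrite -mulr_suml; set z := \sum_(i < p) _ => s0.
have zM : M z.
  apply: (submod_sum hM) => i _; rewrite -mulrA; apply: MM => //; apply: aA.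
  by rewrite /bump /= add1n ltnS.
have a0 : a 0%N * m = 0.
  apply: (hn _ (- z)); [exact: aA|exact: submodN hM zM|].
  by rewrite mulNr; apply/eqP; rewrite -addr_eq0 s0.
have z0 : z = 0 by apply: hc; [apply: MA|rewrite a0 add0r in s0].
move=> [_|k kp]; first by rewrite mulr1.
rewrite exprSr !mulrA -(mulrA _ m) (IH (fun k => a k.+1)) ?mul0r //.
  by move=> i ip; apply: aA.
by rewrite -[RHS]z0; apply: eq_bigr => i _; rewrite mulrA.
Qed.

Lemma strong_nice_ann n A B a b :
  ns_udim n A -> ns_udim n B -> nicely_essential true A B ->
  A a -> A b -> (forall r, A r -> a * r * b = 0) -> forall y, B y -> a * y * b = 0.
Proof.
move=> [hA [v vA indv] hle _] [hB _ _ hns] hn aA bA hab y yB.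
have [_ AB _ /(_ isT y yB)[c cA [hc cyA]]] := hn.
pose M m := A m /\ forall r, A r -> m * r * b = 0.
have hM : submod A M.
  split; first by split=> [|r _]; [apply: subring0|rewrite !mul0r].
    move=> p q [pA hp] [qA hq]; split=> [|r rA]; first exact: subringD.
    by rewrite !mulrDl hp // hq // addr0.
  move=> r p rA [pA hp]; split=> [|t tA]; first exact: subringM.
  by rewrite -!mulrA (mulrA p) hp // mulr0.
have Mc m : M m -> M (m * c).
  move=> [mA hm]; split=> [|r rA]; first exact: subringM.
  by rewrite -(mulrA m) hm //; apply: subringM.
have MA : subset_of M A by move=> ? [].
have aM : M a by [].
have [vnz _] := indv.
(* A nonzero [v i * a] lies in [M], hence has a nonzero multiple [m' * c], and
   [m' * (c * y) * b = 0] because [c * y] is in [A]. The resulting [n] independent elements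
   [s i * v i] all kill [a * y * b]. *)
have hs i : exists s, [/\ A s, s * v i != 0 & s * v i * (a * y * b) = 0].
  case: (eqVneq (v i * a) 0) => [va|va].
    exists 1; split; [exact: subring1|by rewrite mul1r vnz ?inE|].
    by rewrite mul1r !mulrA va !mul0r.
  have vaM : M (v i * a) by case: hM => _ _; apply.
  have [s [sA snz [m' m'M e]]] := essential_mulr hA hle hM MA cA Mc hc vaM va.
  exists s; split=> //.
    by apply: contraNneq snz; rewrite mulrA => ->; rewrite mul0r.
  have -> : s * v i * (a * y * b) = s * (v i * a) * y * b by rewrite !mulrA.
  by rewrite e -(mulrA m'); have [_ ->] := m'M.
have [s {}hs] := choice hs.
apply: (hns _ [set: 'I_n] (fun i => s i * v i)) => //.
- apply: (nice_indep hB hn) => [i _|].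
    by apply: subringM => //; have [] := hs i.
  by apply: indep_scale => // i _; have [] := hs i.
- by move=> i _; apply: AB; apply: subringM => //; have [] := hs i.
- by rewrite cardsT card_ord.
- by apply: subringM (AB _ bA) => //; apply: subringM => //; apply: AB.
- by move=> i _; have [] := hs i.
Qed.

Lemma strong_nice_prime n A B :
  ns_udim n A -> ns_udim n B -> nicely_essential true A B ->
  prime_ring B -> prime_ring A.
Proof.
move=> gA gB hn pB a b aA bA hab; have [_ AB _ _] := hn.
by apply: pB; [exact: AB|exact: AB|exact: (strong_nice_ann gA gB hn aA bA hab)].
Qed.

Lemma strong_nice_semiprime n A B :
  ns_udim n A -> ns_udim n B -> nicely_essential true A B ->
  semiprime_ring B -> semiprime_ring A.
Proof.
move=> gA gB hn pB a aA haa; have [_ AB _ _] := hn.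
by apply: pB; [exact: AB|exact: (strong_nice_ann gA gB hn aA aA haa)].
Qed.

Lemma prime_semiprime A : prime_ring A -> semiprime_ring A.
Proof. by move=> h a aA /(h _ _ aA aA)[]. Qed.

(* If [a <> 0] has essential left annihilator, then some [a r a <> 0] does too,
   and its left annihilator is strictly larger. *)
Lemma semiprime_nonsingular n A :
  subring A -> semiprime_ring A -> acc_left_ann A -> udim_le A A n ->
  nonsingular n A.
Proof.
move=> hA hsp hacc hle F T v a ind vA nT aA va; apply/eqP/negP => /negP anz.
(* [Z] consists of the nonzero elements with essential left annihilator. *)
pose Z a := [/\ A a, a != 0 & forall g, A g -> g != 0 ->
  exists s, [/\ A s, s * g != 0 & s * g * a = 0]].
have Za : Z a.
  split=> // g gA gnz; apply: contrapT => hn.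
  suff : (#|T| < n)%N by rewrite ltnNge nT.
  apply: (indep_extend hA hle ind vA gA gnz) => s b sA bA s0.
  apply/eqP/negP => /negP sgnz; apply: hn; exists s; split=> //.
  have /(congr1 (fun z => z * a)) := s0; rewrite mul0r mulrDl mulr_suml.
  by rewrite [X in _ + X]big1 ?addr0 // => i iT; rewrite -mulrA va // mulr0.
have step (z : {z | Z z}) : exists z' : {z | Z z},
    (forall s, s * sval z = 0 -> s * sval z' = 0) /\
    exists s, [/\ A s, s * sval z' = 0 & s * sval z != 0].
  case: z => z [zA znz hz] /=.
  have [r rA zrz] : exists2 r, A r & z * r * z != 0.
    apply: contrapT => hr; case/eqP: znz; apply: hsp => // r rA.
    by apply/eqP/negP => /negP ?; apply: hr; exists r.
  have zrA : A (z * r) by apply: subringM.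
  have Zz : Z (z * r * z).
    split=> // [|g gA gnz]; first exact: subringM.
    have [s [sA sg sgz]] := hz g gA gnz; exists s; split=> //.
    by rewrite !mulrA sgz !mul0r.
  exists (exist Z _ Zz); split=> /= [s sz|]; first by rewrite !mulrA sz !mul0r.
  have [|s [sA szr szrz]] := hz _ zrA; first by apply: contraNneq zrz => ->; rewrite mul0r.
  exists s; split=> //; first by rewrite mulrA.
  by apply: contraNneq szr; rewrite mulrA => ->; rewrite mul0r.
have [f hf] := choice step.
pose z k := iter k f (exist Z _ Za).
have [k _ ->|k s [sA hs]|N] := hacc (fun k y => y = sval (z k)).
- by case: (svalP (z k)).
- split=> // _ ->; have [h _] := hf (z k); apply: h; exact: hs.
- move=> /(_ N.+1 (leqnSn _)) h; have [_ [s [sA s0]]] := hf (z N).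
  case/eqP; have [_ ] : left_ann A (fun y => y = sval (z N)) s.
    by apply/h; split=> // _ ->.
  by apply.
Qed.

End Goldie.

(** * Degrees and leading coefficients in an Ore extension *)

Section OreExtension.
Variables (S : nzRingType) (K : S -> Prop) (y : S) (al de : S -> S).

Definition ore_pol (f : S) : Prop := exists m, deg_lt K y f m.

(** The coefficient [c] may be zero, so sums and products of leading coefficients need no case
    distinction on cancellation. *)
Definition lead (f : S) (m : nat) (c : S) : Prop :=
  K c /\ deg_lt K y (f - c * y ^+ m) m.

Hypothesis hK : subring K.
Hypothesis hal : automorphism_on K al.
Hypothesis hde : derivation_on K al de.
Hypothesis hy : forall p, K p -> y * p = al p * y + de p.

Let K0 : K 0 := subring0 hK.
Let K1 : K 1 := subring1 hK.

Let deK p : K p -> K (de p). Proof. by case: hde => h _ _; apply: h. Qed.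

Lemma aut_closed p : K p -> K (al p). Proof. by case: hal => h _; apply: h. Qed.

Lemma autM p q : K p -> K q -> al (p * q) = al p * al q.
Proof. by case: hal => _ [_ [h _]]; apply: h. Qed.

Lemma aut0 : al 0 = 0.
Proof.
case: hal => _ [h _]; have := h 0 0 K0 K0; rewrite addr0 => /eqP.
by rewrite -subr_eq0 opprD addrA subrr add0r oppr_eq0 => /eqP.
Qed.

Lemma aut_eq0 p : K p -> al p = 0 -> p = 0.
Proof. by move=> pK e; case: hal => _ [_ [_ [_ [h _]]]]; apply: h; rewrite ?aut0. Qed.

Lemma aut_surj q : K q -> exists2 p, K p & al p = q.
Proof. by case: hal => _ [_ [_ [_ [_]]]]; apply. Qed.

Lemma iter_aut_closed m p : K p -> K (iter m al p).
Proof. by move=> pK; elim: m => //= m; apply: aut_closed. Qed.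

Lemma iter_autM m p q : K p -> K q -> iter m al (p * q) = iter m al p * iter m al q.
Proof.
by move=> pK qK; elim: m => //= m ->; apply: autM; apply: iter_aut_closed.
Qed.

Lemma iter_aut0 m : iter m al 0 = 0.
Proof. by elim: m => //= m ->; apply: aut0. Qed.

Lemma iter_aut_eq0 m p : K p -> iter m al p = 0 -> p = 0.
Proof.
by move=> pK; elim: m => //= m IH /aut_eq0 h; apply/IH/h/iter_aut_closed.
Qed.

Lemma iter_aut_surj m q : K q -> exists2 p, K p & iter m al p = q.
Proof.
elim: m q => [|m IH] q qK; first by exists q.
by have [r /IH[p pK <-] <-] := aut_surj qK; exists p.
Qed.

Lemma iter_aut_regular m u : K u -> regular_in K u -> regular_in K (iter m al u).
Proof.
move=> uK hu s sK; have [t tK <-] := iter_aut_surj m sK.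
rewrite -!iter_autM //.
split=> /iter_aut_eq0 e.
  by have [/(_ (e (subringM hK tK uK)))-> _] := hu _ tK; rewrite iter_aut0.
by have [_ /(_ (e (subringM hK uK tK)))->] := hu _ tK; rewrite iter_aut0.
Qed.

Lemma regular_inM u v : K u -> K v -> regular_in K u -> regular_in K v ->
  regular_in K (u * v).
Proof.
move=> uK vK hu hv s sK; split.
  rewrite mulrA => /(proj1 (hv _ (subringM hK sK uK))); exact: (proj1 (hu _ sK)).
rewrite -mulrA => /(proj2 (hu _ (subringM hK vK sK))); exact: (proj2 (hv _ sK)).
Qed.

Lemma deg_lt_submod m : submod K (fun f => deg_lt K y f m).
Proof.
split.
- by exists (fun=> 0); split=> //; rewrite big1 // => i _; rewrite mul0r.
- move=> _ _ [c [cK ->]] [d [dK ->]]; exists (fun k => c k + d k).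
  split=> [k|]; first exact: subringD.
  by rewrite -big_split; apply: eq_bigr => i _; rewrite mulrDl.
- move=> r _ rK [c [cK ->]]; exists (fun k => r * c k).
  split=> [k|]; first exact: subringM.
  by rewrite mulr_sumr; apply: eq_bigr => i _; rewrite mulrA.
Qed.

Lemma deg_lt0 f : deg_lt K y f 0 -> f = 0.
Proof. by case=> c [_ ->]; rewrite big_ord0. Qed.

Lemma deg_lt_term m c k : K c -> (k < m)%N -> deg_lt K y (c * y ^+ k) m.
Proof.
move=> cK km; exists (fun j => if j == k then c else 0).
split=> [j|]; first by case: ifP.
rewrite (bigD1 (Ordinal km)) //= eqxx big1 ?addr0 // => i.
by rewrite -val_eqE /= => /negPf->; rewrite mul0r.
Qed.

Lemma deg_lt_leq m n f : (m <= n)%N -> deg_lt K y f m -> deg_lt K y f n.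
Proof.
move=> mn [c [cK ->]]; apply: (submod_sum (deg_lt_submod n)) => i _.
by apply: deg_lt_term => //; apply: leq_trans mn.
Qed.

Lemma deg_ltD m f g : deg_lt K y f m -> deg_lt K y g m -> deg_lt K y (f + g) m.
Proof. by case: (deg_lt_submod m) => _ h _; apply: h. Qed.

Lemma deg_ltZ m p f : K p -> deg_lt K y f m -> deg_lt K y (p * f) m.
Proof. by case: (deg_lt_submod m) => _ _; apply. Qed.

Lemma deg_ltB m f g : deg_lt K y f m -> deg_lt K y g m -> deg_lt K y (f - g) m.
Proof. exact: (submodB hK (deg_lt_submod m)). Qed.

Lemma deg_lt_yM m f : deg_lt K y f m -> deg_lt K y (y * f) m.+1.
Proof.
case=> c [cK ->]; rewrite mulr_sumr; apply: (submod_sum (deg_lt_submod m.+1)) => i _.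
rewrite mulrA hy // mulrDl -mulrA -exprS; apply: deg_ltD; apply: deg_lt_term.
- exact: aut_closed.
- by rewrite ltnS.
- exact: deK.
- by apply: leqW.
Qed.

Lemma deg_lt_ynM n m f : deg_lt K y f m -> deg_lt K y (y ^+ n * f) (n + m).
Proof.
move=> hf; elim: n => [|n IH]; first by rewrite mul1r.
by rewrite exprS -mulrA addSn; apply: deg_lt_yM.
Qed.

Lemma deg_ltM N m k f g : (m + k <= N.+1)%N ->
  deg_lt K y f m -> deg_lt K y g k -> deg_lt K y (f * g) N.
Proof.
move=> mk [c [cK ->]] hg; rewrite mulr_suml.
apply: (submod_sum (deg_lt_submod N)) => i _; rewrite -mulrA; apply: deg_ltZ => //.
apply: deg_lt_leq (deg_lt_ynM i hg); move: (ltn_ord i); lia.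
Qed.

Lemma ore_pol_subring : subring ore_pol.
Proof.
split.
- by exists 1%N; rewrite -(mulr1 1) -(expr0 y); apply: deg_lt_term.
- move=> f g [m hm] [k hk]; exists (maxn m k).
  by apply: deg_ltB; [apply: deg_lt_leq hm|apply: deg_lt_leq hk]; lia.
- by move=> f g [m hm] [k hk]; exists (m + k)%N; apply: deg_ltM hm hk.
Qed.

Lemma lead_term m c : K c -> lead (c * y ^+ m) m c.
Proof. by move=> cK; split=> //; rewrite subrr; case: (deg_lt_submod m). Qed.

Lemma lead_const c : K c -> lead c 0 c.
Proof. by move=> cK; have := lead_term 0 cK; rewrite mulr1. Qed.

Lemma lead_deg_lt f m c : lead f m c -> deg_lt K y f m.+1.
Proof.
move=> [cK h]; rewrite -[f](subrK (c * y ^+ m)); apply: deg_ltD.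
  exact: deg_lt_leq h.
exact: deg_lt_term.
Qed.

Lemma lead0 f m : deg_lt K y f m -> lead f m 0.
Proof. by move=> h; split=> //; rewrite mul0r subr0. Qed.

Lemma lead_ynM m d : K d -> lead (y ^+ m * d) m (iter m al d).
Proof.
move=> dK; elim: m => [|m [cK IH]]; first by rewrite mul1r; apply: lead_const.
split; first exact: iter_aut_closed.
rewrite exprS -mulrA -[y ^+ m * d](subrK (iter m al d * y ^+ m)) mulrDr.
rewrite [y * (iter m al d * _)]mulrA (hy cK) iterS.
rewrite mulrDl -!mulrA [X in _ + X - _]addrC addrA addrK.
apply: deg_ltD; first exact: deg_lt_yM.
by apply: deg_lt_term => //; apply: deK.
Qed.

Lemma leadM f g m k c d : lead f m c -> lead g k d ->
  lead (f * g) (m + k) (c * iter m al d).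
Proof.
move=> hf hg; have [cK hf'] := hf; have [dK hg'] := hg.
have [eK he] := lead_ynM m dK.
split; first exact: subringM.
(* First [f], then [g], is replaced by its leading term; the last summand is the error of moving
   [y ^+ m] past [d]. *)
have -> : f * g - c * iter m al d * y ^+ (m + k) =
  (f - c * y ^+ m) * g + (c * y ^+ m * (g - d * y ^+ k)
     + c * ((y ^+ m * d - iter m al d * y ^+ m) * y ^+ k)).
  rewrite exprD !(mulrBl, mulrBr) !mulrA.
  by rewrite !addrA !subrK.
apply: deg_ltD; last apply: deg_ltD.
- by apply: deg_ltM hf' (lead_deg_lt hg); lia.
- apply: deg_ltM (deg_lt_term cK (ltnSn m)) hg'; lia.
- apply: deg_ltZ => //; apply: deg_ltM he _; last first.
    by rewrite -[y ^+ k]mul1r; apply: deg_lt_term (ltnSn k).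
  lia.
Qed.

Lemma leadZ p f m c : K p -> lead f m c -> lead (p * f) m (p * c).
Proof. by move=> pK hf; have := leadM (lead_const pK) hf. Qed.

(** Surjectivity of [al] allows the leading coefficient to be written to the right of [y ^+ m],
    where it can meet elements of [K] by which a polynomial is multiplied on the right. *)
Lemma deg_lt_right m f : deg_lt K y f m.+1 ->
  exists2 p, K p & deg_lt K y (f - y ^+ m * p) m.
Proof.
case=> c [cK ->]; have [p pK pc] := iter_aut_surj m (cK m).
exists p => //; have [_ he] := lead_ynM m pK; rewrite pc in he.
rewrite big_ord_recr /= -addrA -opprB; apply: deg_ltB => //.
by exists c.
Qed.

Lemma deg_lt_ex_lead m f : deg_lt K y f m -> f != 0 ->
  exists n c, [/\ (n < m)%N, lead f n c & c != 0].
Proof.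
case=> c [cK ->]; elim: m => [|m IH]; first by rewrite big_ord0 eqxx.
rewrite big_ord_recr /=; case: (eqVneq (c m) 0) => [->|cm] fnz.
  rewrite mul0r addr0 in fnz *; have [n [d [nm]]] := IH fnz.
  by exists n, d; split=> //; apply: leqW.
exists m, (c m); split=> //; split=> //.
by rewrite addrK; exists c.
Qed.

Lemma deg_eq_lead f n : deg_eq K y f n <-> exists2 c, lead f n c & c != 0.
Proof.
split=> [[c [cK cn ->]]|[d [dK [c [cK e]]] dnz]].
  by exists (c n) => //; split=> //; rewrite big_ord_recr addrK; exists c.
exists (fun k => if k == n then d else c k); split=> [k||]; first by case: ifP.
  by rewrite eqxx.
rewrite big_ord_recr /= eqxx; apply/eqP; rewrite -subr_eq e; apply/eqP.
by apply: eq_bigr => i _; rewrite ltn_eqF.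
Qed.

Hypothesis free : forall m (c : nat -> S), (forall k, K (c k)) ->
  \sum_(k < m) c k * y ^+ k = 0 -> forall k, (k < m)%N -> c k = 0.

Lemma term_deg_lt m c : K c -> deg_lt K y (c * y ^+ m) m -> c = 0.
Proof.
move=> cK [d [dK e]].
pose b k := if k == m then - c else d k.
have := @free m.+1 b _ _ m (ltnSn m); rewrite /b eqxx => h.
apply/eqP; rewrite -oppr_eq0; apply/eqP/h => [k|].
  by case: ifP => // _; apply: subringN.
rewrite big_ord_recr /= eqxx mulNr e; apply/eqP; rewrite subr_eq0; apply/eqP.
by apply: eq_bigr => i _; rewrite ltn_eqF.
Qed.

Lemma lead_inj f m c d : lead f m c -> lead f m d -> c = d.
Proof.
move=> [cK hc] [dK hd]; apply/eqP; rewrite -subr_eq0; apply/eqP.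
apply: (@term_deg_lt m); first exact: subringB.
have -> : (c - d) * y ^+ m = (f - d * y ^+ m) - (f - c * y ^+ m).
  by rewrite mulrBl opprB [RHS]addrC addrA subrK.
exact: deg_ltB.
Qed.

Lemma lead_eq0 m c : lead 0 m c -> c = 0.
Proof. by move/lead_inj; apply; apply: lead0; case: (deg_lt_submod m). Qed.

Lemma indep_ore_pol (F : finType) (T : {set F}) (c : F -> S) :
  (forall i, i \in T -> K (c i)) -> indep K T c -> indep ore_pol T c.
Proof.
move=> cK [nz ind]; split=> // f fP.
have [m] : exists m, forall i, i \in T -> deg_lt K y (f i) m.
  have hm i : exists m, i \in T -> deg_lt K y (f i) m.
    by case: (boolP (i \in T)) => [/fP[m ?]|_]; [exists m|exists 0%N].
  have [m {}hm] := choice hm; exists (\max_i m i)%N => i iT.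
  by apply: deg_lt_leq (hm i iT); apply: leq_bigmax.
move=> {fP}; elim: m f => [|m IH] f hf s0 i iT.
  by rewrite (deg_lt0 (hf i iT)) mul0r.
have hp j : exists p, j \in T -> K p /\ deg_lt K y (f j - y ^+ m * p) m.
  case: (boolP (j \in T)) => [/hf/deg_lt_right[p ? ?]|_]; first by exists p.
  by exists 0.
have [p {}hp] := choice hp.
have pK j : j \in T -> K (p j) by move=> /hp[].
have pcK j : j \in T -> K (p j * c j) by move=> jT; apply: subringM; [|apply: pK|apply: cK].
pose f' j := f j - y ^+ m * p j.
have sK : K (\sum_(j in T) p j * c j) by apply: (submod_sum (subring_submod hK)).
have e : y ^+ m * (\sum_(j in T) p j * c j) + \sum_(j in T) f' j * c j = 0.
  rewrite -[RHS]s0 mulr_sumr -big_split; apply: eq_bigr => j _ /=.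
  by rewrite mulrA -mulrDl addrC subrK.
have hf' : deg_lt K y (\sum_(j in T) f' j * c j) m.
  apply: (submod_sum (deg_lt_submod m)) => j jT.
  apply: (@deg_ltM _ m 1); first by rewrite addn1.
    by have [] := hp j jT.
  by rewrite -[c j]mulr1 -(expr0 y); apply: deg_lt_term => //; apply: cK.
have s1 : \sum_(j in T) p j * c j = 0.
  apply: (@iter_aut_eq0 m) => //; apply: (@lead_inj (y ^+ m * (\sum_(j in T) p j * c j)) m).
    exact: lead_ynM.
  apply: lead0; move/eqP: e; rewrite addr_eq0 => /eqP->.
  exact: (submodN hK (deg_lt_submod m)).
have pc0 := ind p pK s1.
have ff j : j \in T -> f j * c j = f' j * c j.
  by move=> jT; rewrite mulrBl -mulrA pc0 // mulr0 subr0.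
rewrite ff //; apply: IH => // [j jT|]; first by have [] := hp j jT.
by rewrite -[RHS]s0; apply: eq_bigr => j jT; rewrite ff.
Qed.

End OreExtension.

(* [b B am^k(b) = 0] for all [k > 0] makes the [am^k(b)] pairwise orthogonal. *)
Lemma semiprime_aut_orthogonal (S : nzRingType) (B : S -> Prop) am n b :
  subring B -> semiprime_ring B -> udim_le B B n -> automorphism_on B am -> B b ->
  (forall j r, B r -> b * r * iter j.+1 am b = 0) -> b = 0.
Proof.
move=> hB hsp hle ham bB hb; apply/eqP/negP => /negP bnz.
pose w k := iter k am b.
have wB k : B (w k) by apply: iter_aut_closed.
have lt_orth i k r : (i < k)%N -> B r -> w i * r * w k = 0.
  move=> ik rB; have [r' r'B <-] := iter_aut_surj ham i rB.
  have -> : w k = iter i am (iter (k - i).-1.+1 am b).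
    by rewrite -iterD; congr (iter _ am b); lia.
  have cB := iter_aut_closed ham (k - i).-1.+1 bB.
  rewrite /w -!(iter_autM ham) //; last exact: subringM.
  by rewrite hb // (iter_aut0 hB ham).
have orth i k r : i != k -> B r -> w i * r * w k = 0.
  rewrite neq_ltn => /orP[ik|ki] rB; first exact: lt_orth.
  (* In the opposite order semiprimeness is used: with [z = w i * r * w k], each [z * t * z]
     contains the factor [w k * t * w i], which is already zero. *)
  have zB : B (w i * r * w k) by apply: subringM => //; apply: subringM.
  apply: hsp => // t tB.
  have -> : w i * r * w k * t * (w i * r * w k) = w i * r * (w k * t * w i) * (r * w k).
    by rewrite !mulrA.
  by rewrite (lt_orth k i) // mulr0 mul0r.
apply: (@udim_le_seq _ B B n w hle) => // [k|m a aB s0 k km].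
  by apply: contraNneq bnz => /(iter_aut_eq0 hB ham bB)->.
have akB := aB _ km.
(* Multiplying the relation on the right by [t * a k * w k] leaves only its [k]-th term, by
   orthogonality. *)
apply: hsp; [exact: subringM|move=> t tB].
have tB' : B (t * a k) by apply: subringM.
have /(congr1 (fun z => z * (t * a k * w k))) := s0.
rewrite mul0r mulr_suml (bigD1 (Ordinal km)) //= big1 ?addr0 => [e|i].
  by rewrite -[RHS]e !mulrA.
rewrite -val_eqE /= => ik.
by rewrite -mulrA (mulrA (w i)) orth ?mulr0.
Qed.

(** * Special subextensions: dimension, nonsingularity and primeness through leading terms *)

Section SpecialSubextension.
Variables (S : nzRingType) (K : S -> Prop) (y : S) (al de : S -> S).
Hypothesis hK : subring K.
Hypothesis hal : automorphism_on K al.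
Hypothesis hde : derivation_on K al de.
Hypothesis hy : forall p, K p -> y * p = al p * y + de p.
Hypothesis free : forall m (c : nat -> S), (forall k, K (c k)) ->
  \sum_(k < m) c k * y ^+ k = 0 -> forall k, (k < m)%N -> c k = 0.

Local Notation lead := (lead K y).
Local Notation deg_lt := (deg_lt K y).

Let K0 : K 0 := subring0 hK.
Let K1 : K 1 := subring1 hK.

Variables (A : S -> Prop) (B : nat -> S -> Prop) (d : nat).
Hypothesis hA : subring A.
Hypothesis hdec : forall a, A a -> exists (n : nat) (c : nat -> S),
  (forall k, K (c k) /\ A (c k * y ^+ k)) /\ a = \sum_(k < n) c k * y ^+ k.
Hypothesis dpos : (0 < d)%N.
Hypothesis hDeg : forall n, Deg K y A n <-> exists k, n = (d * k)%N.
Hypothesis hB0 : forall p, B 0%N p <-> A p /\ K p.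

(* [ups * iter m al p = am p * ups] says that [ups * y ^+ m] commutes past [p]
   up to [am] and terms of lower degree; [u * q = b * ups] is
   [u q y^m = b lambda_m] with [y ^+ m] cancelled. *)
Definition attached (m : nat) (ups : S) (am : S -> S) : Prop :=
  (K ups /\ regular_in K ups /\ A (ups * y ^+ m)) /\
  (subring (B m) /\ subset_of (B m) (B 0%N) /\ automorphism_on (B m) am) /\
  (forall p, B m p -> ups * iter m al p = am p * ups) /\
  (forall q, K q -> A (q * y ^+ m) ->
     exists u b, [/\ B m u, regular_in K u, B m b & u * q = b * ups]).

Hypothesis hatt : forall m, Deg K y A m -> exists ups am, attached m ups am.

Let A0 : A 0 := subring0 hA.
Let DegM k : Deg K y A (d * k). Proof. by apply/hDeg; exists k. Qed.

Let B0A p : B 0%N p -> A p. Proof. by case/hB0. Qed.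
Let B0K p : B 0%N p -> K p. Proof. by case/hB0. Qed.

Let hB0' : subring (B 0%N).
Proof.
split; first by apply/hB0; split; [apply: subring1|].
  by move=> a b /hB0[? ?] /hB0[? ?]; apply/hB0; split; apply: subringB.
by move=> a b /hB0[? ?] /hB0[? ?]; apply/hB0; split; apply: subringM.
Qed.

(** The sum given by [hdec] may be longer than [m]; freeness makes the surplus top terms vanish. *)
Lemma special_repr f m : A f -> deg_lt f m -> exists c : nat -> S,
  (forall k, K (c k) /\ A (c k * y ^+ k)) /\ f = \sum_(k < m) c k * y ^+ k.
Proof.
case/hdec=> N [c [hc ->]]; elim: N => [|N IH] hf.
  exists (fun=> 0); split=> [k|]; first by rewrite mul0r.
  by rewrite big_ord0 big1 // => i _; rewrite mul0r.
case: (leqP N.+1 m) => Nm.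
  exists (fun k => if (k < N.+1)%N then c k else 0); split=> [k|].
    by case: ifP => _; rewrite ?mul0r.
  rewrite (big_ord_widen m (fun k => c k * y ^+ k) Nm) big_mkcond /=.
  by apply: eq_bigr => i _; case: ifP => _; rewrite ?mul0r.
have cN : c N = 0.
  apply: (term_deg_lt hK free (m := N)); first by have [] := hc N.
  have -> : c N * y ^+ N = \sum_(k < N.+1) c k * y ^+ k - \sum_(k < N) c k * y ^+ k.
    by rewrite big_ord_recr /= addrAC subrr add0r.
  apply: (deg_ltB hK); first exact: deg_lt_leq hf.
  by exists c; split=> // k; have [] := hc k.
have e : \sum_(k < N.+1) c k * y ^+ k = \sum_(k < N) c k * y ^+ k.
  by rewrite big_ord_recr /= cN mul0r addr0.
by rewrite e; apply: IH; rewrite -e.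
Qed.

Lemma lead_special f m c : A f -> lead f m c -> A (c * y ^+ m).
Proof.
move=> fA hf; have [e [he fe]] := special_repr fA (lead_deg_lt hK hf).
suff -> : c = e m by have [] := he m.
apply: (lead_inj hK free hf); rewrite fe big_ord_recr /=; split.
  by have [] := he m.
by rewrite addrK; exists e; split=> // k; have [] := he k.
Qed.

Lemma degree_special c m : K c -> A (c * y ^+ m) -> c != 0 -> exists k, m = (d * k)%N.
Proof.
move=> cK cA cnz; apply/hDeg; exists (c * y ^+ m); split=> //.
  apply: contraNneq cnz => e; apply/eqP/(term_deg_lt hK free (m := m)) => //.
  by rewrite e; case: (deg_lt_submod y hK m).
by apply/deg_eq_lead; exists c => //; apply: lead_term.
Qed.

Lemma special_ex_lead f : A f -> f != 0 ->
  exists e c, [/\ lead f (d * e) c, c != 0 & A (c * y ^+ (d * e))].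
Proof.
move=> fA fnz; have [N [c0 [hc fe]]] := hdec fA.
have hf : deg_lt f N by exists c0; split=> // k; have [] := hc k.
have [n [c [_ hl cnz]]] := deg_lt_ex_lead hf fnz.
have cA := lead_special fA hl; have [cK _] := hl.
by have [e ne] := degree_special cK cA cnz; subst n; exists e, c.
Qed.

(** No element of [A] has a term of degree strictly between [d * j] and [d * j.+1], so consecutive
    filtration steps differ by one term. *)
Lemma special_split f j : A f -> deg_lt f (d * j.+1) ->
  exists c, A (c * y ^+ (d * j)) /\ lead f (d * j) c.
Proof.
move=> fA hf.
have [c [hc fe]] := special_repr fA hf.
exists (c (d * j)%N); have [cK cA] := hc (d * j)%N; split=> //; split=> //.
have lt : (d * j < d * j.+1)%N by rewrite ltn_mul2l dpos /=.
rewrite fe (bigD1 (Ordinal lt)) //= addrAC subrr add0r.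
apply: (submod_sum (deg_lt_submod y hK _)) => i; rewrite -val_eqE /= => ij.
have [iK iA] := hc i; case: (ltnP i (d * j)) => idj; first exact: deg_lt_term.
suff -> : c i = 0 by rewrite mul0r; case: (deg_lt_submod y hK (d * j)).
apply/eqP/negP => /negP/(degree_special iK iA)[k ik].
have := ltn_ord i; rewrite [X in (X < _)%N]ik ltn_mul2l dpos ltnS /= => kj.
case/negP: ij; rewrite ik eqn_mul2l; apply/orP; right.
by move: idj; rewrite ik leq_mul2l; case: (d) dpos => //= _ _ jk; rewrite eqn_leq kj.
Qed.

Lemma leadD f g m c c' : lead f m c -> lead g m c' -> lead (f + g) m (c + c').
Proof.
move=> [cK hf] [c'K hg]; split; first exact: subringD.
by rewrite mulrDl opprD addrACA; apply: (deg_ltD hK).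
Qed.

(** The [j]-th graded piece of [V], zero included. It is realised by actual terms in [A], so that it
    can serve as the complement [W] in [udim_le_ext]. *)
Definition lead_piece (V : S -> Prop) (j : nat) (w : S) : Prop :=
  exists c f, [/\ V f, deg_lt f (d * j.+1), lead f (d * j) c,
                  A (c * y ^+ (d * j)) & w = c * y ^+ (d * j)].

Lemma lead_piece_submod V j : submod A V -> submod (B 0%N) (lead_piece V j).
Proof.
move=> [V0 VD VM]; split.
- exists 0, 0; rewrite mul0r; split=> //; first by case: (deg_lt_submod y hK (d * j.+1)).
  by apply: (lead0 hK); case: (deg_lt_submod y hK (d * j)).
- move=> _ _ [c [f [fV hf hl cA ->]]] [c' [f' [fV' hf' hl' cA' ->]]].
  exists (c + c'), (f + f'); rewrite mulrDl; split=> //.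
  + exact: VD.
  + exact: (deg_ltD hK).
  + exact: leadD.
  + exact: subringD.
- move=> r _ rB [c [f [fV hf hl cA ->]]]; exists (r * c), (r * f); split.
  + exact/VM/fV/B0A.
  + exact/(deg_ltZ hK)/hf/B0K.
  + exact: (leadZ hK hal hde hy (B0K rB) hl).
  + by rewrite -mulrA; apply: subringM => //; apply: B0A.
  + by rewrite mulrA.
Qed.

Lemma udim_le_filtered V l : submod A V -> subset_of V A ->
  (forall j, udim_le (B 0%N) (lead_piece V j) l) ->
  forall J, udim_le (B 0%N) (fun f => V f /\ deg_lt f (d * J)) (l * J).
Proof.
move=> hV VA hl; elim=> [|J IH].
  move=> F T v hv [nz _]; rewrite muln0 leqn0 cards_eq0; apply/eqP/setP => i.
  rewrite in_set0; apply/negP => iT; have [_] := hv i iT.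
  by rewrite muln0 => /deg_lt0 v0; have := nz i iT; rewrite v0 eqxx.
have hV0 := submod_sub B0A hV.
have hdl k := submod_sub B0K (deg_lt_submod y hK k).
rewrite [(l * _)%N]mulnS [(l + _)%N]addnC.
apply: (udim_le_ext (U := fun f => deg_lt f (d * J)) (W := lead_piece V J)) => //.
- exact: submodI.
- exact: lead_piece_submod.
- move=> f [fV hf]; have [c [cA hc]] := special_split (VA _ fV) hf.
  by exists (c * y ^+ (d * J)); [exists c, f|case: hc].
- move=> w hw [c [f [_ _ [cK _] _ e]]]; subst w.
  by rewrite (term_deg_lt hK free cK hw) mul0r.
- by apply: udim_le_eq IH => f [[]].
Qed.

Variable n : nat.
Hypothesis gB : forall m, Deg K y A m -> ns_udim n (B m).

Let gB0 : ns_udim n (B 0%N).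
Proof. by apply: gB; apply/hDeg; exists 0%N; rewrite muln0. Qed.

(** In [u * q = b * ups], regularity of [ups] makes the left annihilators of [u * q] and [b] in
    [B 0] agree, while regularity of [u] keeps [b] nonzero. Thus [ann_not_essential] reaches
    coefficients [q] outside [B 0]. *)
Lemma special_ann_not_essential q j : K q -> A (q * y ^+ (d * j)) -> q != 0 ->
  exists g, [/\ B 0%N g, g != 0 & forall s, B 0%N s -> s * g * q = 0 -> s * g = 0].
Proof.
move=> qK qA qnz; have [ups [am [[uK [ureg uA]] [[_ [BB _]] [_ hu]]]]] := hatt (DegM j).
have [u [b [uB ru bB e]]] := hu q qK qA.
have [_ hge _ hns] := gB0.
apply: (ann_not_essential hB0' hge hns (BB _ uB) (BB _ bB)) => [|s sB su|s sB].
- apply: contraNneq qnz => b0; apply/eqP; have [_] := ru q qK; apply.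
  by rewrite e b0 mul0r.
- by have [h _] := ru s (B0K sB); apply: h.
- rewrite -mulrA e mulrA => h.
  have [h' _] := ureg (s * b) (B0K (subringM hB0' sB (BB _ bB))).
  exact: h'.
Qed.

(** Multiplication by [lambda_(dj)] raises the degree by [d * j]; a further factor [g] from [B 0]
    ensures that a multiple of the result by [B 0] drops in degree only if it vanishes. *)
Lemma special_multiple f : A f -> f != 0 -> exists e, forall j, exists h q,
  [/\ exists2 a, A a & h = a * f, lead h (d * (e + j)) q, h != 0
    & forall s, B 0%N s -> deg_lt (s * h) (d * (e + j)) -> s * h = 0].
Proof.
move=> fA fnz; have [e [c [hl cnz cA]]] := special_ex_lead fA fnz.
exists e => j; have [cK _] := hl.
have [ups [am [[uK [ureg uA]] _]]] := hatt (DegM j).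
pose q := ups * iter (d * j) al c.
have icK := iter_aut_closed hal (d * j) cK.
have qK : K q by apply: subringM.
have hq : lead (ups * y ^+ (d * j) * f) (d * (j + e)) q.
  by rewrite mulnDr; apply: (leadM hK hal hde hy _ hl); apply: lead_term.
have qA : A (q * y ^+ (d * (j + e))).
  by apply: lead_special hq; apply: subringM.
have qnz : q != 0.
  apply: contraNneq cnz => q0; apply/eqP/(iter_aut_eq0 hK hal (m := d * j)) => //.
  by have [_] := ureg _ icK; apply.
have [g [gB' gnz hg]] := special_ann_not_essential qK qA qnz.
have hgl := leadZ hK hal hde hy (B0K gB') hq.
exists (g * (ups * y ^+ (d * j) * f)), (g * q); rewrite [(e + j)%N]addnC; split=> //.
- exists (g * (ups * y ^+ (d * j))); last by rewrite !mulrA.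
  by apply: subringM => //; apply: B0A.
- apply: contraNneq gnz => h0.
  have gq0 : g * q = 0 by apply: (lead_eq0 hK free (m := d * (j + e))); rewrite -h0.
  by rewrite -[g]mul1r hg ?mul1r //; apply: subring1.
- move=> s sB hs; rewrite mulrA (hg s sB) ?mul0r //.
  have h1 := leadZ hK hal hde hy (B0K sB) hgl.
  by rewrite -mulrA (lead_inj hK free h1 (lead0 hK hs)).
Qed.

(* Multiplying [m] independent elements by the [lambda_(dj)], [j < J], gives [m J]
   independent elements over [B 0] in degrees below [d (M + J)], where at most
   [l (M + J)] of them fit. *)
Lemma udim_le_special V l : submod A V -> subset_of V A ->
  (forall j, udim_le (B 0%N) (lead_piece V j) l) -> udim_le A V l.
Proof.
move=> hV VA hl F T f fV ind; rewrite leqNgt; apply/negP => lT.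
have [nz indT] := ind.
have [e he] : exists e : F -> nat, forall i, i \in T -> forall j, exists h q,
  [/\ exists2 a, A a & h = a * f i, lead h (d * (e i + j)) q, h != 0
    & forall s, B 0%N s -> deg_lt (s * h) (d * (e i + j)) -> s * h = 0].
  have hi i : exists e, i \in T -> forall j, exists h q,
    [/\ exists2 a, A a & h = a * f i, lead h (d * (e + j)) q, h != 0
    & forall s, B 0%N s -> deg_lt (s * h) (d * (e + j)) -> s * h = 0].
    case: (boolP (i \in T)) => [iT|_]; last by exists 0%N.
    by have [e he] := special_multiple (VA _ (fV _ iT)) (nz _ iT); exists e.
  by have [e he] := choice hi; exists e.
have [g hg] : exists g : F * nat -> S, forall p, p.1 \in T ->
  [/\ A (g p), exists q, lead (g p * f p.1) (d * (e p.1 + p.2)) q,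
      g p * f p.1 != 0
    & forall s, B 0%N s -> deg_lt (s * (g p * f p.1)) (d * (e p.1 + p.2)) ->
        s * (g p * f p.1) = 0].
  have hi (p : F * nat) : exists g, p.1 \in T ->
    [/\ A g, exists q, lead (g * f p.1) (d * (e p.1 + p.2)) q,
      g * f p.1 != 0
    & forall s, B 0%N s -> deg_lt (s * (g * f p.1)) (d * (e p.1 + p.2)) ->
        s * (g * f p.1) = 0].
    case: (boolP (p.1 \in T)) => [iT|_]; last by exists 0.
    have [_ [q [[a aA ->] h1 h2 h3]]] := he _ iT p.2.
    by exists a => _; split=> //; exists q.
  by have [g hg] := choice hi; exists g.
(* [J > l * M] is exactly what makes [l.+1 * J] exceed [l * (M + J)]. *)
pose M := (\max_i e i)%N; pose J := (l * M).+1.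
pose T' := setX T [set: 'I_J].
suff : (#|T'| <= l * (M + J))%N.
  rewrite cardsX cardsT card_ord leqNgt; case/negP.
  apply: (@leq_trans (l.+1 * J)); last by rewrite leq_mul2r lT orbT.
  rewrite /J; nia.
apply: (udim_le_filtered hV VA hl (v := fun p : F * 'I_J => g (p.1, p.2 : nat) * f p.1)).
  move=> [i j] /setXP[iT _] /=; have [gA [q hq] _ _] := hg (i, j : nat) iT.
  split; first by case: hV => _ _; apply=> //; apply: fV.
  apply: deg_lt_leq (lead_deg_lt hK hq) => //=.
  rewrite -(addn1 (d * _)); have eM : (e i <= M)%N by apply: (leq_bigmax i).
  have : (d * (e i + j).+1 <= d * (M + J))%N.
    by rewrite leq_mul2l; apply/orP; right; move: (ltn_ord j); lia.
  rewrite mulnS; lia.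
split=> [[i j] /setXP[iT _]|a aB s0]; first by have [] := hg (i, j : nat) iT.
have aB' i j : i \in T -> B 0%N (a (i, j)).
  by move=> iT; apply: aB; apply/setXP; split; [|rewrite inE].
(* Grouped by [i], the relation over [B 0] is one over [A] among the [f i], so each group vanishes;
   inside a group the degrees increase with [j], and [triangular_sum] applies. *)
have s1 : \sum_(i in T) (\sum_(j < J) a (i, j) * g (i, j : nat)) * f i = 0.
  rewrite -[RHS]s0; under eq_bigr do rewrite mulr_suml.
  rewrite pair_big_dep /=; apply: eq_big => [[i j]|[i j] _] /=.
    by rewrite in_setX inE andbT.
  by rewrite mulrA.
have s2 : forall i, i \in T -> (\sum_(j < J) a (i, j) * g (i, j : nat)) * f i = 0.
  apply: indT => // i iT; apply: (submod_sum (subring_submod hA)) => j _.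
  apply: subringM => //; first exact/B0A/aB'.
  by have [] := hg (i, j : nat) iT.
move=> [i j] /setXP[iT _] /=.
have := @triangular_sum _ (B 0%N) (fun k => g (i, k) * f i)
  (fun k f => deg_lt f (d * (e i + k))) hB0' _ _ _ _ J (fun k => a (i, inord k)).
move=> /(_ _ _ _ _ _ _ j (ltn_ord j)); rewrite inord_val; apply.
- by move=> k; apply: submod_sub (deg_lt_submod y hK _).
- by move=> k h; apply: deg_lt_leq => //; rewrite leq_mul2l addnS leqnSn orbT.
- move=> k; have [_ [q hq] _ _] := hg (i, k) iT.
  apply: deg_lt_leq (lead_deg_lt hK hq) => //=.
  by rewrite ltn_mul2l dpos /= addnS.
- by move=> k s sB; have [_ _ _] := hg (i, k) iT; apply.
- by move=> k _; apply: aB'.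
- rewrite -[RHS](s2 i iT) mulr_suml; apply: eq_bigr => k _.
  by rewrite inord_val mulrA.
Qed.

(** Independent leading terms are carried into the attached ring along [u * q i = b i * ups]. A
    relation among the [b i], multiplied by [ups * y ^+ (d * j)], becomes one among the terms, and
    [ups] cancels afterwards. *)
Lemma piece_indep j F (T : {set F}) (q : F -> S) ups am :
  attached (d * j) ups am ->
  (forall i, i \in T -> K (q i) /\ A (q i * y ^+ (d * j))) ->
  indep (B 0%N) T (fun i => q i * y ^+ (d * j)) ->
  exists2 b : F -> S,
    forall i, i \in T -> B (d * j) (b i) /\ exists2 u, B (d * j) u & u * q i = b i * ups
    & indep (B 0%N) T b.
Proof.
move=> [[uK [ureg _]] [[_ [BB _]] [_ hu]]] hq [nz ind].
have hi i : exists p : S * S, i \in T ->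
    [/\ B (d * j) p.1, regular_in K p.1, B (d * j) p.2 & p.1 * q i = p.2 * ups].
  case: (boolP (i \in T)) => [iT|_]; last by exists (0, 0).
  by have [qK qA] := hq i iT; have [u [b h]] := hu _ qK qA; exists (u, b).
have [p hp] := choice hi.
exists (fun i => (p i).2) => [i iT|]; have BK b : B (d * j) b -> K b by move/BB/B0K.
  by have [? _ ? ?] := hp i iT; split=> //; exists (p i).1.
split=> [i iT|a aB s0 i iT].
  have [_ preg _ e] := hp i iT; apply: contraNneq (nz i iT) => p0.
  have [qK _] := hq i iT; have [_ ->] := preg _ qK; first by rewrite mul0r.
  by rewrite e p0 mul0r.
have [uB preg bB e] := hp i iT.
have := ind (fun i => a i * (p i).1) _ _ i iT.
rewrite mulrA -(mulrA (a i)) e => h.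
have [r _] := ureg (a i * (p i).2) (B0K (subringM hB0' (aB i iT) (BB _ bB))); apply: r.
apply: (term_deg_lt hK free (m := d * j)).
  by apply: subringM => //; apply: B0K; apply: subringM => //; [apply: aB|apply: BB].
rewrite -(mulrA (a i)) h //; first by case: (deg_lt_submod y hK (d * j)).
  by move=> k kT; apply: subringM => //; [apply: aB|apply: BB; have [] := hp k kT].
have /(congr1 (fun z => z * (ups * y ^+ (d * j)))) := s0.
rewrite mul0r mulr_suml => s1; rewrite -[RHS]s1; apply: eq_bigr => k kT.
have [_ _ _ ek] := hp k kT.
by rewrite !mulrA -(mulrA (a k)) ek !mulrA.
Qed.

(** The transported family lies in [B (d * j)] and is independent over it, so the dimension of that
    attached ring bounds the piece. *)
Lemma udim_le_piece V j : udim_le (B 0%N) (lead_piece V j) n.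
Proof.
move=> F T v hv ind.
have hq i : exists q, i \in T -> [/\ K q, A (q * y ^+ (d * j)) & v i = q * y ^+ (d * j)].
  case: (boolP (i \in T)) => [/hv[c [f [_ _ [cK _] cA ->]]]|_]; last by exists 0.
  by exists c.
have [q {}hq] := choice hq.
have [ups [am hat]] := hatt (DegM j).
have [||b hb indb] := piece_indep (T := T) (q := q) hat.
- by move=> i /hq[].
- by apply: indep_eq ind => i /hq[].
have [_ [[_ [BB _]] _]] := hat.
have [_ _ hle _] := gB (DegM j).
by apply: hle (indep_sub BB indb) => i /hb[].
Qed.

Lemma special_udim_le : udim_le A A n.
Proof.
apply: udim_le_special (subring_submod hA) _ _ => // j.
exact: udim_le_piece.
Qed.

(** The left annihilator [V] of [a] contains [n] independent elements, so by [udim_le_special] some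
    piece of [V] has [n] independent leading terms. Carried into an attached ring, they kill a
    nonzero [z] built from the leading coefficient of [a], which [indep_ann] forbids. *)
Lemma special_nonsingular : (0 < n)%N -> nonsingular n A.
Proof.
move=> npos F T v a ind vA nT aA va; apply/eqP/negP => /negP anz.
have [e [c [hl cnz _]]] := special_ex_lead aA anz.
pose V f := A f /\ f * a = 0.
have hV : submod A V.
  split; first by rewrite /V mul0r.
    move=> f g [fA f0] [gA g0]; split; first exact: subringD.
    by rewrite mulrDl f0 g0 addr0.
  move=> r f rA [fA f0]; split; first exact: subringM.
  by rewrite -mulrA f0 mulr0.
have VA : subset_of V A by move=> f [].
have [j hj] : exists j, ~ udim_le (B 0%N) (lead_piece V j) n.-1.
  apply: contrapT => hn; have : (#|T| <= n.-1)%N; last by lia.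
  apply: (udim_le_special hV VA _ _ ind) => [j|i iT]; last by split; [apply: vA|apply: va].
  by apply: contrapT => hj; apply: hn; exists j.
apply: hj => F' T' w hw indw; rewrite leqNgt; apply/negP => nT'.
have {}nT' : (n <= #|T'|)%N by lia.
have hq i : exists q, i \in T' -> [/\ K q, A (q * y ^+ (d * j)), w i = q * y ^+ (d * j)
    & q * iter (d * j) al c = 0].
  case: (boolP (i \in T')) => [/hw[q [f [[_ fa] _ hf qA ->]]]|_]; last by exists 0.
  exists q => _; split=> //; first by case: hf.
  have := leadM hK hal hde hy hf hl; rewrite fa; exact: lead_eq0.
have [q {}hq] := choice hq.
have [ups [am hat]] := hatt (DegM j).
have [||b hb indb] := piece_indep (T := T') (q := q) hat.
- by move=> i /hq[].
- by apply: indep_eq indw => i /hq[].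
have [[uK [ureg uA]] [[_ [BB _]] _]] := hat.
have [cK _] := hl; have icK := iter_aut_closed hal (d * j) cK.
pose z := ups * iter (d * j) al c.
have zK : K z by apply: subringM.
have zA : A (z * y ^+ (d * (j + e))).
  apply: (@lead_special (ups * y ^+ (d * j) * a)); first exact: subringM.
  by rewrite mulnDr; apply: (leadM hK hal hde hy _ hl); apply: lead_term.
have znz : z != 0.
  apply: contraNneq cnz => z0; apply/eqP/(iter_aut_eq0 hK hal (m := d * j)) => //.
  by have [_] := ureg _ icK; apply.
have [g [gB' gnz hg]] := special_ann_not_essential zK zA znz.
case/eqP: gnz; apply: (indep_ann gB0 indb _ nT' (q := z)) => // i iT'.
  by apply: BB; have [] := hb i iT'.
have [_ [u uB e1]] := hb i iT'; have [_ _ _ q0] := hq i iT'.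
by rewrite /z mulrA -e1 -mulrA q0 mulr0.
Qed.



(** For [am r' = r], the product of [f], [r' * lambda^j] and [g] is zero. Moving [ups] and [v j] to
    the right past elements of [B m], at the cost of powers of [am], shows that its leading
    coefficient is [b * r * iter j.+1 am b'] times a regular element. *)
Lemma lead_mul_eq0 m ups am b b' f g : attached m ups am ->
  B m b -> B m b' -> lead f m (b * ups) -> lead g m (b' * ups) ->
  (forall r, A r -> f * r * g = 0) ->
  forall j r, B m r -> b * r * iter j.+1 am b' = 0.
Proof.
move=> [[uK [ureg uA]] [[hBm [BB ham]] [hcomm _]]] bB b'B hf hg fg j.
have BK p : B m p -> K p by move/BB/B0K.
(* [v j] is the leading coefficient of [(ups * y ^+ m) ^+ j]. *)
pose v j := iter j (fun v => ups * iter m al v) 1.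
have vK i : K (v i).
  by elim: i => [//|i IH] /=; apply: subringM => //; apply: iter_aut_closed.
have vreg i : regular_in K (v i).
  elim: i => [|i IH] /=; first by move=> s sK; rewrite mulr1 mul1r.
  by apply: regular_inM => //; [apply: iter_aut_closed|apply: iter_aut_regular].
have iB i p : B m p -> B m (iter i am p).
  by move=> pB; elim: i => //= i IH; apply: (aut_closed ham).
have vcomm i p : B m p -> v i * iter (i * m) al p = iter i am p * v i.
  move=> pB; elim: i => [|i IH]; first by rewrite mul1r mulr1.
  rewrite /= -mulrA mulSn iterD -(iter_autM hal) //; last first.
    by apply: (iter_aut_closed hal); apply: BK.
  rewrite IH (iter_autM hal) //; last exact/BK/iB.
  by rewrite mulrA hcomm ?mulrA //; apply: iB.
have hlam i : lead ((ups * y ^+ m) ^+ i) (i * m) (v i).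
  elim: i => [|i IH]; first exact: lead_const.
  by rewrite exprS mulSn; apply: (leadM hK hal hde hy _ IH); apply: lead_term.
move=> r rB; have [r' r'B <-] := aut_surj ham rB.
set P := b * am r' * iter j.+1 am b'.
have PB : B m P.
  by apply: subringM (iB j.+1 _ b'B) => //; apply: subringM => //; apply: (aut_closed ham).
have h1 := leadM hK hal hde hy (leadZ hK hal hde hy (BK _ r'B) (hlam j)) hg.
have := leadM hK hal hde hy hf h1.
have rA : A (r' * (ups * y ^+ m) ^+ j).
  apply: subringM => //; first exact/B0A/BB.
  elim: (j) => [|i IH]; first exact: subring1.
  by rewrite exprS; apply: subringM.
rewrite mulrA fg //.
move=> /(lead_eq0 hK free) e.
have juK := iter_aut_closed hal (j * m) uK.
have hreg : regular_in K (v j * iter (j * m) al ups).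
  by apply: regular_inM => //; apply: iter_aut_regular.
have rjB : B m (r' * iter j am b') by apply: subringM => //; apply: iB.
have : P * (ups * iter m al (v j * iter (j * m) al ups)) = 0.
  rewrite -[RHS]e (iter_autM hal (j * m) (BK _ b'B) uK).
  rewrite -(mulrA r') (mulrA (v j)) (vcomm j b' b'B) -!(mulrA (iter j am b')) (mulrA r').
  rewrite (iter_autM hal m (BK _ rjB)); last exact: subringM.
  rewrite -(mulrA b) (mulrA ups) (hcomm _ rjB).
  by rewrite (autM ham r'B (iB _ _ b'B)) /P /= !mulrA.
have vuK := subringM hK (vK j) juK.
have [h _] := regular_inM hK uK (iter_aut_closed hal m vuK) ureg
  (iter_aut_regular hK hal m vuK hreg) (BK _ PB).
exact: h.
Qed.

(** Multiply by [lambda_(dk)] to reach the degree, then by the [u] that the attached ring provides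
    for the new leading coefficient. The free shift [k] serves to bring two elements to the same
    degree. *)
Lemma special_lead_shift f e c k ups am : A f -> lead f (d * e) c -> c != 0 ->
  attached (d * (k + e)) ups am ->
  exists a b, [/\ A a, B (d * (k + e)) b, b != 0 & lead (a * f) (d * (k + e)) (b * ups)].
Proof.
move=> fA hl cnz [[uK [ureg uA]] [[hBm [BB ham]] [_ hu]]].
have [cK _] := hl; have icK := iter_aut_closed hal (d * k) cK.
have [ups' [_ [[uK' [ureg' uA']] _]]] := hatt (DegM k).
have hq := leadM hK hal hde hy (lead_term y hK (d * k) uK') hl.
rewrite -mulnDr in hq; have [qK _] := hq.
have qA := lead_special (subringM hA uA' fA) hq.
have [u [b [uB rb bB e1]]] := hu _ qK qA.
exists (u * (ups' * y ^+ (d * k))), b; split=> //.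
- by apply: subringM => //; apply/B0A/BB.
- apply: contraNneq cnz => b0; apply/eqP/(iter_aut_eq0 hK hal (m := d * k)) => //.
  have [_] := ureg' _ icK; apply; have [_] := rb _ qK; apply.
  by rewrite e1 b0 mul0r.
- by rewrite -e1 -mulrA; apply: (leadZ hK hal hde hy) => //; apply/B0K/BB.
Qed.

Lemma special_prime : (forall m, Deg K y A m -> prime_ring (B m)) -> prime_ring A.
Proof.
move=> hp f g fA gA fg.
case: (eqVneq f 0) => [->|fnz]; first by left.
case: (eqVneq g 0) => [->|gnz]; first by right.
have [e [c [hf cnz _]]] := special_ex_lead fA fnz.
have [e' [c' [hg cnz' _]]] := special_ex_lead gA gnz.
(* In the common degree [d * (e' + e)] both leading coefficients come from one attached ring. *)
have [ups [am hat]] := hatt (DegM (e' + e)).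
have [a [b [aA bB bnz hl]]] := special_lead_shift fA hf cnz hat.
have [a' [b' [aA' bB' bnz' hl']]] : exists a b, [/\ A a, B (d * (e' + e)) b, b != 0
    & lead (a * g) (d * (e' + e)) (b * ups)].
  by move: hat; rewrite addnC => hat; apply: special_lead_shift hg cnz' hat.
have h r : B (d * (e' + e)) r -> b * r * am b' = 0.
  apply: (lead_mul_eq0 hat bB bB' hl hl' _ 0) => r' rA.
  have -> : a * f * r' * (a' * g) = a * (f * (r' * a') * g) by rewrite !mulrA.
  by rewrite fg ?mulr0 //; apply: subringM.
have [_ [[hBm [_ ham]] _]] := hat.
case: (hp _ (DegM (e' + e)) _ _ bB (aut_closed ham bB') h)
  => [b0|/(aut_eq0 hBm ham bB') b0].
  by rewrite b0 eqxx in bnz.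
by rewrite b0 eqxx in bnz'.
Qed.

Lemma special_semiprime :
  (forall m, Deg K y A m -> semiprime_ring (B m)) -> semiprime_ring A.
Proof.
move=> hp f fA ff; apply/eqP/negP => /negP fnz.
have [e [c [hf cnz _]]] := special_ex_lead fA fnz.
(* The shift is by zero; it only brings the leading coefficient to the form [b * ups]. *)
have [ups [am hat]] := hatt (DegM (0 + e)).
have [a [b [aA bB bnz hl]]] := special_lead_shift fA hf cnz hat.
have [_ [[hBm [_ ham]] _]] := hat.
have [_ _ hle _] := gB (DegM (0 + e)).
case/eqP: bnz; apply: (semiprime_aut_orthogonal hBm (hp _ (DegM _)) hle ham bB).
apply: (lead_mul_eq0 hat bB bB hl hl) => r' rA.
have -> : a * f * r' * (a * f) = a * (f * (r' * a) * f) by rewrite !mulrA.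
by rewrite ff ?mulr0 //; apply: subringM.
Qed.

End SpecialSubextension.

(** * From the attached rings to a special subextension *)

Section SpecialTransfer.
Variables (S : nzRingType) (K : S -> Prop) (y : S) (al de : S -> S).
Hypothesis hK : subring K.
Hypothesis hal : automorphism_on K al.
Hypothesis hde : derivation_on K al de.
Hypothesis hy : forall p, K p -> y * p = al p * y + de p.
Hypothesis free : forall m (c : nat -> S), (forall k, K (c k)) ->
  \sum_(k < m) c k * y ^+ k = 0 -> forall k, (k < m)%N -> c k = 0.

(** In degree zero the data are [1] and the identity. In positive degrees, comparing leading
    coefficients turns the degree condition and the equation in [A] into identities in [K]. *)
Lemma special_attached T A B m : special_subext K y T A B -> Deg K y A m ->
  exists ups am, attached K y al A B m ups am.
Proof.
move=> [hA [_ [_ [hdec [_ [hB0 hsp]]]]]] dm; have K1 := subring1 hK.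
case: (eqVneq m 0%N) => [->|mnz].
  exists 1, id; split; last split; last split.
  - by split=> //; split=> [s _|]; rewrite !mulr1 ?mul1r //; apply: subring1.
  - split; last split=> //; last by do !split=> //; move=> q qB; exists q.
    split; first by apply/hB0; split=> //; apply: subring1.
      by move=> a b /hB0[? ?] /hB0[? ?]; apply/hB0; split; apply: subringB.
    by move=> a b /hB0[? ?] /hB0[? ?]; apply/hB0; split; apply: subringM.
  - by move=> p _ /=; rewrite mulr1 mul1r.
  - move=> q qK; rewrite mulr1 => qA; exists 1, q; split=> //.
    + by apply/hB0; split=> //; apply: subring1.
    + by move=> s _; rewrite mulr1 mul1r.
    + exact/hB0.
    + by rewrite mulr1 mul1r.
have [ups [am [uK [ureg [uA [hBm [BB [ham [hc hu]]]]]]]]] := hsp m dm mnz.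
exists ups, am; split=> //; split; last split.
- by split=> //; split=> // p /BB/hB0.
- move=> p pB; have [_ pK] := BB _ pB.
  apply: (lead_inj hK free (f := ups * y ^+ m * p) (m := m)).
    have := leadM hK hal hde hy (lead_term y hK m uK) (lead_const y hK pK).
    by rewrite addn0.
  split; last by rewrite -(mulrA (am p)); apply: hc.
  by apply: subringM => //; have [_ +] := BB _ (aut_closed ham pB).
- move=> q qK qA; have [u [uB ru [b bB e]]] := hu q qK qA; exists u, b; split=> //.
  have [_ uK'] := BB _ uB; have [_ bK] := BB _ bB.
  apply: (lead_inj hK free (f := u * q * y ^+ m) (m := m)).
    by apply: lead_term => //; apply: subringM.
  by rewrite e mulrA; apply: lead_term => //; apply: subringM.
Qed.

Lemma special_transfer n T A B : (0 < n)%N -> special_subext K y T A B ->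
  (forall m, Deg K y A m -> ns_udim n (B m)) -> udim_ge A n ->
  [/\ ns_udim n A,
      (forall m, Deg K y A m -> prime_ring (B m)) -> prime_ring A &
      (forall m, Deg K y A m -> semiprime_ring (B m)) -> semiprime_ring A].
Proof.
move=> npos sp gB hge; have hatt m := @special_attached T A B m sp.
have [hA [_ [_ [hdec [[d [_ hDeg]] [hB0 _]]]]]] := sp.
(* If [d = 0], only constants occur, so [A] is [B 0] itself. *)
case: (posnP d) => [d0|dpos].
  have AB : A = B 0%N.
    apply/funext => p; apply/propext; split=> [pA|/hB0[]//]; apply/hB0; split=> //.
    have [N [c [hc ->]]] := hdec _ pA.
    apply: (submod_sum (subring_submod hK)) => i _; have [cK cA] := hc i.
    case: (eqVneq (c i) 0) => [->|cnz]; first by rewrite mul0r; apply: subring0.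
    have [k ik] := degree_special hK free hDeg cK cA cnz.
    by move: cK; rewrite ik d0 mul0n mulr1.
  have D0 : Deg K y A 0 by apply/hDeg; exists 0%N; rewrite muln0.
  by rewrite {1 3 5}AB; split=> [|/(_ _ D0)|/(_ _ D0)] //; apply: gB.
split.
- split=> //.
    exact: (special_udim_le hK hal hde hy free hA hdec dpos hDeg hB0 hatt gB).
  exact: (special_nonsingular hK hal hde hy free hA hdec dpos hDeg hB0 hatt gB npos).
- exact: (special_prime hK hal hde hy free hA hdec hDeg hB0 hatt).
- exact: (special_semiprime hK hal hde hy free hA hdec hDeg hB0 hatt gB).
Qed.

End SpecialTransfer.

(** * Skew polynomial rings over a well-ordered set of variables *)

Section SkewPolynomials.
Variables (S : nzRingType) (R : S -> Prop) (I : Type) (lt : I -> I -> Prop).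
Variables (x : I -> S) (alpha delta : I -> S -> S).
Hypothesis skew : skew_poly_bijective R lt x alpha delta.

Local Notation Sk := (Sk R lt x).
Local Notation seg := (seg lt).
Local Notation nondecr := (nondecr lt).
Local Notation monom := (monom x).
Local Notation pol j := (ore_pol (Sk (seg j)) (x j)).

Let hR : subring R. Proof. by case: skew. Qed.
Let R0 : R 0 := subring0 hR.
Let ltxx i : ~ lt i i. Proof. by case: skew => _ [h _ _ _] _ _ _; apply: h. Qed.
Let lt_trans i j k : lt i j -> lt j k -> lt i k.
Proof. by case: skew => _ [_ h _ _] _ _ _; apply: h. Qed.
Let lt_total i j : [\/ lt i j, i = j | lt j i].
Proof. by case: skew => _ [_ _ h _] _ _ _; apply: h. Qed.
Let lt_wf : well_founded lt. Proof. by case: skew => _ []. Qed.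

Lemma monom_cat_nseq t k i : monom (t ++ nseq k i) = monom t * x i ^+ k.
Proof. by rewrite /Defs.monom big_cat big_nseq iter_mulr_1. Qed.

Lemma nondecr_behead a t : nondecr (a :: t) -> nondecr t.
Proof. by case: t => //= b t []. Qed.

Lemma nondecr_cat_nseq t k i :
  nondecr t -> all_in (seg i) t -> nondecr (t ++ nseq k i).
Proof.
elim: t => [_ _|a t IH nd ain] /=.
  by elim: k => //= -[|k] //= IH; split=> //; right.
have {}IH : nondecr (t ++ nseq k i).
  by apply: IH (nondecr_behead nd) _ => s st; apply: ain; right.
case: t nd ain IH => [|b t] nd ain IH /=; last by case: nd.
by case: k IH => //= k IH; split=> //; left; apply: ain; left.
Qed.

(** Splitting off the block of the largest variable [j] displays the monomial as one in smaller
    variables times a power of [x j]. *)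
Lemma nondecr_split t : nondecr t -> t = [::] \/ exists j t1 k,
  [/\ List.In j t, all_in (seg j) t1, nondecr t1 & t = t1 ++ nseq k j].
Proof.
elim: t => [|a t IH] nd; first by left.
right; case: (IH (nondecr_behead nd)) => [->|[j [t1 [k [jt t1j nd1 e]]]]].
  by exists a, [::], 1%N; split=> //; left.
case: t1 t1j nd1 e => [|b t1] t1j nd1 e.
  case: k e => [e|k e]; first by rewrite e in jt.
  have [aj|aj] : lt a j \/ a = j by move: nd; rewrite e /= => -[].
    exists j, [:: a], k.+1; split=> //; [by right|by move=> s [<-|]|by rewrite e].
  by exists j, [::], k.+2; split=> //; [right|rewrite e aj].
have ab : lt a b \/ a = b by move: nd; rewrite e /= => -[].
exists j, (a :: b :: t1), k; split=> //; [by right| |by rewrite e].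
move=> s [<-|st]; last exact: t1j.
have bj : lt b j by apply: t1j; left.
by case: ab => [/lt_trans|->]; [apply|].
Qed.

Lemma cat_nseq_inj i t t' k k' : all_in (seg i) t -> all_in (seg i) t' ->
  t ++ nseq k i = t' ++ nseq k' i -> t = t' /\ k = k'.
Proof.
elim: t t' => [|a t IH] [|b t'] hs hs' /=.
- by move/(congr1 size); rewrite !size_nseq.
- by case: k => //= k [e _]; case: (@ltxx i); rewrite {1}e; apply: hs'; left.
- by clear IH; case: k' => //= k' [e _]; case: (@ltxx i); rewrite -{1}e; apply: hs; left.
case=> -> /IH[s st|s st|-> ->] //; [apply: hs|apply: hs']; by right.
Qed.

Lemma Sk_sum D (F : finType) (t : F -> seq I) (r : F -> S) :
  (forall i, all_in D (t i)) -> (forall i, nondecr (t i)) -> (forall i, R (r i)) ->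
  Sk D (\sum_i r i * monom (t i)).
Proof.
move=> tD nd rR; exists #|F|, (fun k => t (enum_val k)), (fun k => r (enum_val k)).
by split=> //; rewrite (reindex _ (onW_bij _ (@enum_val_bij F))).
Qed.

Lemma SkD D f g : Sk D f -> Sk D g -> Sk D (f + g).
Proof.
move=> [n [t [r [tD nd rR ->]]]] [n' [t' [r' [tD' nd' rR' ->]]]].
pose tt (i : 'I_n + 'I_n') := match i with inl i => t i | inr i => t' i end.
pose rr (i : 'I_n + 'I_n') := match i with inl i => r i | inr i => r' i end.
rewrite (_ : _ + _ = \sum_i rr i * monom (tt i)); last by rewrite big_sumType.
by apply: Sk_sum => -[].
Qed.

Lemma Sk_term D r t : all_in D t -> nondecr t -> R r -> Sk D (r * monom t).
Proof.
by move=> tD nd rR; exists 1%N, (fun=> t), (fun=> r); split=> //; rewrite big_ord1.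
Qed.

Lemma Sk_R D r : R r -> Sk D r.
Proof.
by move=> rR; have := @Sk_term D r [::]; rewrite /Defs.monom big_nil mulr1; apply.
Qed.

Lemma SkN D f : Sk D f -> Sk D (- f).
Proof.
move=> [n [t [r [tD nd rR ->]]]]; exists n, t, (fun k => - r k); split=> // [k|].
  exact: subringN.
by rewrite -sumrN; apply: eq_bigr => k _; rewrite mulNr.
Qed.

Lemma Sk_ind (P : S -> Prop) D : P 0 -> (forall f g, P f -> P g -> P (f + g)) ->
  (forall r t, R r -> nondecr t -> all_in D t -> P (r * monom t)) ->
  forall f, Sk D f -> P f.
Proof.
move=> P0 PD Pt _ [n [t [r [tD nd rR ->]]]].
by apply: (big_ind P) => // k _; apply: Pt.
Qed.

Lemma pol_Sk D j f : D j -> (forall s, lt s j -> D s) -> pol j f -> Sk D f.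
Proof.
move=> Dj Dd [m [c [cS ->]]]; apply: (big_ind (Sk D)); [exact: Sk_R|exact: SkD|move=> k _].
move: (c k) (cS k); apply: (@Sk_ind (fun f => Sk D (f * _))) => [|f' g'|r t rR nd tj].
- by rewrite mul0r; apply: Sk_R.
- by rewrite mulrDl; apply: SkD.
rewrite -mulrA -monom_cat_nseq; apply: Sk_term => //; last exact: nondecr_cat_nseq.
move=> s st; have [/tj/Dd//|] := List.in_app_or _ _ _ st.
by move=> {st}; elim: (k : nat) => //= k' IH [<-|/IH].
Qed.

Lemma Sk_pol_term j f : Sk (seg j) f -> pol j f.
Proof. by move=> hf; exists 1%N; exists (fun=> f); rewrite big_ord1 mulr1. Qed.

Lemma pol_mono i j f : lt i j -> pol i f -> pol j f.
Proof.
by move=> ij /(@pol_Sk (seg j)) h; apply/Sk_pol_term/h => // s /lt_trans; apply.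
Qed.

Let ore j : [/\ automorphism_on (Sk (seg j)) (alpha j),
  derivation_on (Sk (seg j)) (alpha j) (delta j) &
  forall p, Sk (seg j) p -> x j * p = alpha j p * x j + delta j p].
Proof. by case: skew => _ _ _ _; apply. Qed.

Lemma pol_subring j : subring (Sk (seg j)) -> subring (pol j).
Proof. by move=> hj; have [h1 h2 h3] := ore j; apply: ore_pol_subring h3. Qed.

Section Segment.
Variable D : I -> Prop.
Hypothesis D_down : forall i j, D j -> lt i j -> D i.
Hypothesis D_subring : forall j, D j -> subring (Sk (seg j)).

(** Only finitely many variables occur in [f], and it is a polynomial in the largest of them over
    the segment below. *)
Lemma Sk_pol f : Sk D f -> R f \/ exists2 j, D j & pol j f.
Proof.
move: f; apply: (@Sk_ind (fun f => R f \/ exists2 j, D j & pol j f)) => [|f g|r t rR nd tD].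
- by left.
- have addp j f' g' : D j -> pol j f' -> pol j g' -> pol j (f' + g').
    by move=> Dj; apply: subringD; apply/pol_subring/D_subring.
  move=> [fR|[i Di fi]] [gR|[j Dj gj]].
  - by left; apply: subringD.
  - by right; exists j => //; apply: addp => //; apply/Sk_pol_term/Sk_R.
  - by right; exists i => //; apply: addp => //; apply/Sk_pol_term/Sk_R.
  - right; case: (lt_total i j) => [ij|ij|ji].
    + by exists j => //; apply: addp => //; apply: pol_mono fi.
    + by exists j => //; apply: addp => //; rewrite -ij.
    + by exists i => //; apply: addp => //; apply: pol_mono gj.
case: (nondecr_split nd) => [->|[j [t1 [k [jt t1j nd1 e]]]]].
  by left; rewrite /Defs.monom big_nil mulr1.
right; exists j; first exact: tD.
rewrite e monom_cat_nseq mulrA; exists k.+1; apply: deg_lt_term => //.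
  exact/D_subring/tD.
exact: Sk_term.
Qed.

Lemma Sk_pol_seq (s : seq S) : (forall f, f \in s -> Sk D f) ->
  (forall f, f \in s -> R f) \/ exists2 j, D j & forall f, f \in s -> pol j f.
Proof.
elim: s => [_|f s IH hs]; first by left.
have [|fR|[i Di fi]] := @Sk_pol f; first by apply: hs; rewrite inE eqxx.
  have [g gs|sR|[j Dj sj]] := IH; first by apply: hs; rewrite inE gs orbT.
    by left=> g; rewrite inE => /predU1P[->|/sR].
  by right; exists j => // g; rewrite inE => /predU1P[->|/sj//]; apply/Sk_pol_term/Sk_R.
have [g gs|sR|[j Dj sj]] := IH; first by apply: hs; rewrite inE gs orbT.
  right; exists i => // g; rewrite inE => /predU1P[->//|/sR gR].
  exact/Sk_pol_term/Sk_R.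
right; case: (lt_total i j) => [ij|ij|ji].
- by exists j => // g; rewrite inE => /predU1P[->|/sj//]; apply: pol_mono fi.
- by exists j => // g; rewrite inE => /predU1P[->|/sj//]; rewrite -ij.
- by exists i => // g; rewrite inE => /predU1P[->//|/sj]; apply: pol_mono.
Qed.

(** Two elements lie together in [R] or in one Ore extension over a smaller segment, where their
    product can be formed. This is the inductive step of [Sk_subring]. *)
Lemma Sk_subring_step : subring (Sk D).
Proof.
split; first by apply: Sk_R; apply: subring1.
  by move=> f g hf hg; apply: SkD => //; apply: SkN.
move=> f g hf hg; have [e he|h|[j Dj h]] := @Sk_pol_seq [:: f; g].
- by move: he; rewrite !inE => /orP[] /eqP->.
- by apply: Sk_R; apply: subringM => //; apply: h; rewrite !inE eqxx ?orbT.
- apply: (@pol_Sk _ j) => // [s sj|]; first exact: D_down sj.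
  have hp : subring (pol j) by apply: pol_subring; apply: D_subring.
  by apply: subringM => //; apply: h; rewrite !inE eqxx ?orbT.
Qed.

End Segment.

Lemma Sk_subring i : subring (Sk (seg i)).
Proof.
elim: i / (lt_wf i) => i _ IH; apply: Sk_subring_step => // j k ki jk.
exact: lt_trans jk ki.
Qed.

(** Freeness is given for pairwise distinct monomials; [rep] picks one index for each monomial, so
    that equal ones can be collected first. *)
Let rep (F : finType) (t : F -> seq I) i := odflt i [pick j | `[< t j = t i >]].

Let repP (F : finType) (t : F -> seq I) i : t (rep t i) = t i.
Proof. by rewrite /rep; case: pickP => [j /asboolP|]. Qed.

Let rep_eq (F : finType) (t : F -> seq I) i j : t i = t j -> rep t i = rep t j.
Proof.
rewrite /rep => ->; case: pickP => [//|/(_ j)].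
by move/asboolP; case.
Qed.

Let rep_sum (F : finType) (t : F -> seq I) (r : F -> S) :
  \sum_i r i * monom (t i)
  = \sum_(j | rep t j == j) (\sum_(i | rep t i == j) r i) * monom (t j).
Proof.
rewrite (partition_big (rep t) (fun j => rep t j == j)) /=; last first.
  by move=> i _; apply/eqP/rep_eq/repP.
apply: eq_bigr => j _; rewrite mulr_suml; apply: eq_bigr => i /eqP <-.
by rewrite repP.
Qed.

Lemma monom_free (F : finType) (t : F -> seq I) (r : F -> S) :
  (forall i, nondecr (t i)) -> (forall i, R (r i)) ->
  \sum_i r i * monom (t i) = 0 -> forall u, \sum_(i | `[< t i = u >]) r i = 0.
Proof.
move=> nd rR; rewrite rep_sum => s0 u.
case: (pselect (exists i, t i = u)) => [[i0 <-]|hn]; last first.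
  by rewrite big1 // => i /asboolP iu; case: hn; exists i.
pose P := [set j | rep t j == j].
have [_ _ hfree _ _] := skew.
have iP : rep t i0 \in P by rewrite inE; apply/eqP/rep_eq/repP.
have := hfree #|P| (fun k => t (enum_val k))
  (fun k => \sum_(i | rep t i == enum_val k) r i).
move=> /(_ _ _ _ _ (enum_rank_in iP (rep t i0))).
rewrite enum_rankK_in // => h.
rewrite (eq_bigl (fun i => rep t i == rep t i0)) ?h //.
- move=> j k /rep_eq e; apply: enum_val_inj.
  have := enum_valP j; have := enum_valP k.
  by rewrite !inE => /eqP<- /eqP<-.
- by move=> k; apply: (submod_sum (subring_submod hR)).
- rewrite -[RHS]s0 [RHS](eq_bigl (fun j => j \in P)) => [|j]; last by rewrite inE.
  exact: (esym (@big_enum_val _ _ _ _ (pred_of_set P)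
    (fun j => (\sum_(i | rep t i == j) r i) * monom (t j)))).
- move=> i; apply/asboolP/eqP => [/rep_eq//|e].
  by rewrite -(repP t i) e repP.
Qed.

(** Padding with zero coefficients lets several elements be written with a common number of
    terms. *)
Lemma Sk_nat D f : Sk D f -> exists (n : nat) (t : nat -> seq I) (r : nat -> S),
  [/\ forall k, all_in D (t k), forall k, nondecr (t k), forall k, R (r k) &
      forall N, (n <= N)%N -> f = \sum_(k < N) r k * monom (t k)].
Proof.
move=> [n [t [r [tD nd rR ->]]]].
exists n, (fun k => if insub k is Some o then t o else [::]),
  (fun k => if insub k is Some o then r o else 0); split=> [k|k|k|N nN].
- by case: insub => [o|s []]; first exact: tD.
- by case: insub.
- by case: insub.
pose G k := (if insub k is Some o then r o else 0)
  * monom (if insub k is Some o then t o else [::]).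
rewrite (bigID (fun k : 'I_N => (k < n)%N)) /= [X in _ + X]big1 ?addr0; last first.
  by move=> k kn; rewrite insubF ?mul0r //; apply/negbTE.
by rewrite -(big_ord_widen N G nN); apply: eq_bigr => k _; rewrite /G valK.
Qed.

(** The monomials of [c k] followed by [k] copies of [i] are again standard, and by [cat_nseq_inj]
    different [k] never give the same monomial. *)
Lemma Sk_free i m (c : nat -> S) : (forall k, Sk (seg i) (c k)) ->
  \sum_(k < m) c k * x i ^+ k = 0 -> forall k, (k < m)%N -> c k = 0.
Proof.
move=> cS s0.
have [n hn] := choice (fun k => Sk_nat (cS k)).
have [t ht] := choice hn; have [r hr] := choice ht => {hn ht}.
pose N := (\max_(k < m) n k)%N.
have ce k : (k < m)%N -> c k = \sum_(j < N) r k j * monom (t k j).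
  move=> km; have [_ _ _] := hr k; apply.
  exact: (leq_bigmax (Ordinal km)).
pose tt (p : 'I_m * 'I_N) := t p.1 p.2 ++ nseq p.1 i.
have h := @monom_free _ tt (fun p => r p.1 p.2).
have {}h : forall u, \sum_(p | `[< tt p = u >]) r p.1 p.2 = 0.
  apply: h => [p|p|].
  - by have [tD nd _ _] := hr p.1; apply: nondecr_cat_nseq.
  - by have [_ _ rR _] := hr p.1; apply: rR.
  rewrite -[RHS]s0 [LHS](eq_bigr (fun p : 'I_m * 'I_N =>
    r p.1 p.2 * monom (t p.1 p.2) * x i ^+ p.1)); last first.
    by move=> p _; rewrite monom_cat_nseq mulrA.
  rewrite -(pair_big xpredT xpredT (fun (k : 'I_m) (j : 'I_N) =>
    r k j * monom (t k j) * x i ^+ k)) /=.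
  by apply: eq_bigr => k _; rewrite ce // mulr_suml.
move=> k km; rewrite ce // (rep_sum (fun j : 'I_N => t k j) (fun j => r k j)).
apply: big1 => j /eqP jj; rewrite [X in X * _](_ : _ = 0) ?mul0r //.
rewrite -[RHS](h (tt (Ordinal km, j))) (eq_bigl (fun p : 'I_m * 'I_N =>
  (p.1 == Ordinal km) && `[< t k p.2 = t k j >])); last first.
  move=> [k' j']; apply/asboolP/andP => /= [e|[/eqP-> /asboolP e]]; last first.
    by rewrite /tt /= e.
  have [tD _ _ _] := hr k'; have [tD' _ _ _] := hr k.
  have [e1 e2] := cat_nseq_inj (tD _) (tD' _) e.
  split; first by apply/eqP/val_inj.
  by apply/asboolP; rewrite -e1 /= e2.
rewrite -(pair_big_dep (fun k' : 'I_m => k' == Ordinal km)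
  (fun (_ : 'I_m) (j' : 'I_N) => `[< t k j' = t k j >])
  (fun (k' : 'I_m) (j' : 'I_N) => r k' j')) /= big_pred1_eq /=.
apply: eq_bigl => j'; apply/eqP/asboolP => [<-|e]; last first.
  by rewrite -jj; apply: rep_eq.
by rewrite (repP (fun j : 'I_N => t k j)).
Qed.

(** Well-founded induction on segments: the coefficients of a relation lie together in [R] or in one
    Ore extension over a smaller segment, where [indep_ore_pol] applies. *)
Lemma indep_Sk (F : finType) (T : {set F}) (c : F -> S) :
  (forall i, i \in T -> R (c i)) -> indep R T c -> indep (fun=> True) T c.
Proof.
move=> cR indR; have [nz ind] := indR.
have step D : (forall j, D j -> indep (Sk (seg j)) T c) -> indep (Sk D) T c.
  move=> hD; split=> // a aS s0.
  have [|f|h|[j Dj h]] := @Sk_pol_seq D _ [seq a i | i <- enum T].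
  - by move=> j _; apply: Sk_subring.
  - by move=> /mapP[i]; rewrite mem_enum => iT ->; apply: aS.
  - apply: ind => // i iT; apply: h; apply/mapP; exists i => //.
    by rewrite mem_enum.
  have [h1 h2 h3] := ore j.
  have [_ hp] := indep_ore_pol (Sk_subring j) h1 h2 h3 (@Sk_free j)
    (fun i iT => Sk_R _ (cR i iT)) (hD j Dj).
  apply: hp => // i iT; apply: h; apply/mapP; exists i => //.
  by rewrite mem_enum.
have hseg i : indep (Sk (seg i)) T c by elim: i / (lt_wf i) => i _ IH; apply: step.
by apply: indep_sub (step (fun=> True) (fun j _ => hseg j)) => f _; case: skew.
Qed.

(** * Unions of chains, and the induction over essentially special subextensions *)

Lemma chain_seq (Lam : I -> Prop) (Af : I -> S -> Prop) (s : seq S) :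
  (exists i, Lam i) ->
  (forall i j, Lam i -> Lam j -> lt i j -> subset_of (Af i) (Af j)) ->
  (forall f, f \in s -> exists2 i, Lam i & Af i f) ->
  exists2 i, Lam i & forall f, f \in s -> Af i f.
Proof.
move=> [i0 L0] inc; elim: s => [|f s IH] hs; first by exists i0.
have [|i Li fi] := hs f; first by rewrite inE eqxx.
have [g gs|j Lj sj] := IH; first by apply: hs; rewrite inE gs orbT.
case: (lt_total i j) => [ij|ij|ji].
- by exists j => // g; rewrite inE => /predU1P[->|/sj//]; apply: inc fi.
- by exists j => // g; rewrite inE => /predU1P[->|/sj//]; rewrite -ij.
- by exists i => // g; rewrite inE => /predU1P[->//|/sj]; apply: inc.
Qed.

(** The upper bound and nonsingularity concern finitely many elements, which lie in one [Af i], and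
    independence over [A] restricts to [Af i]. The lower bound is supplied by [hge]. *)
Lemma chain_ns_udim n (A : S -> Prop) (Lam : I -> Prop) (Af : I -> S -> Prop) :
  (exists i, Lam i) ->
  (forall i j, Lam i -> Lam j -> lt i j -> subset_of (Af i) (Af j)) ->
  (forall a, A a <-> exists2 i, Lam i & Af i a) ->
  (forall i, Lam i -> ns_udim n (Af i)) -> udim_ge A n -> ns_udim n A.
Proof.
move=> L0 inc hA gAf hge.
have AfA i : Lam i -> subset_of (Af i) A by move=> Li a ai; apply/hA; exists i.
have bnd (s : seq S) : (forall f, f \in s -> A f) ->
    exists2 i, Lam i & forall f, f \in s -> Af i f.
  by move=> hs; apply: (chain_seq L0 inc) => f /hs/hA.
split=> //.
- split.
  + by have [i Li] := L0; have [/subring1 h _ _ _] := gAf i Li; apply: AfA h.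
  + move=> a b aA bA; have [e|i Li h] := bnd [:: a; b].
      by rewrite !inE => /orP[]/eqP->.
    have [hi _ _ _] := gAf i Li.
    by apply: (AfA i Li); apply: subringB => //; apply: h; rewrite !inE eqxx ?orbT.
  + move=> a b aA bA; have [e|i Li h] := bnd [:: a; b].
      by rewrite !inE => /orP[]/eqP->.
    have [hi _ _ _] := gAf i Li.
    by apply: (AfA i Li); apply: subringM => //; apply: h; rewrite !inE eqxx ?orbT.
- move=> F T v vA ind; have [f|i Li h] := bnd [seq v k | k <- enum T].
    by move=> /mapP[k]; rewrite mem_enum => kT ->; apply: vA.
  have [_ _ hle _] := gAf i Li; apply: (hle _ T v); last exact: indep_sub (AfA i Li) ind.
  by move=> k kT; apply: h; apply/mapP; exists k; rewrite // mem_enum.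
- move=> F T v a ind vA nT aA va; have [f|i Li h] := bnd (a :: [seq v k | k <- enum T]).
    rewrite inE => /predU1P[->//|/mapP[k]].
    by rewrite mem_enum => kT ->; apply: vA.
  have [_ _ _ hns] := gAf i Li.
  apply: (hns _ T v) => //; first exact: indep_sub (AfA i Li) ind.
    move=> k kT; apply: h; rewrite inE; apply/orP; right.
    by apply/mapP; exists k; rewrite // mem_enum.
  by apply: h; rewrite inE eqxx.
Qed.

(** The multipliers come from all of [S]; the multiples are still independent because the family in
    [R] is independent over [S] by [indep_Sk]. *)
Lemma udim_ge_touch n A : udim_ge R n ->
  (forall c, R c -> c != 0 -> exists2 a, a * c != 0 & A (a * c)) -> udim_ge A n.
Proof.
move=> [c cR indc] hA; have [nz _] := indc.
have ha i : exists a, a * c i != 0 /\ A (a * c i).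
  by have [|a ? ?] := hA _ (cR i); [apply: nz; rewrite inE|exists a].
have [a {}ha] := choice ha.
exists (fun i => a i * c i) => [i|]; first by have [] := ha i.
apply: (@indep_sub _ _ (fun=> True)) => //; apply: indep_scale => // [|i _].
  exact: indep_Sk.
by have [] := ha i.
Qed.

Lemma ess_ns_udim n strong D A : (0 < n)%N -> ns_udim n R -> ess R lt x strong D A ->
  [/\ ns_udim n A, strong -> prime_ring R -> prime_ring A
    & strong -> semiprime_ring R -> semiprime_ring A].
Proof.
move=> npos gR; have [_ hge _ _] := gR => he.
(* The induction also carries that every nonzero element of [R] has a nonzero left multiple in [A];
   this yields the lower bound at each stage. *)
suff [] : (forall c, R c -> c != 0 -> exists2 a, a * c != 0 & A (a * c)) /\
  [/\ ns_udim n A, strong -> prime_ring R -> prime_ring A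
    & strong -> semiprime_ring R -> semiprime_ring A] by [].
have nice_touch A' B' : subset_of R B' -> nicely_essential strong A' B' ->
    forall c, R c -> c != 0 -> exists2 a, a * c != 0 & A' (a * c).
  move=> RB [_ _ hE _] c cR cnz.
  have [e|a _ /(_ c)[]] := hE [:: c]; last by exists a.
    by rewrite inE => /eqP->; split=> //; apply: RB.
  by rewrite inE.
elim: he => {D A} [D A _ hn|D A Lam Af _ _ _ Lex inc _ IH hA|
    D A i At B _ _ sp RAt _ _ _ IH hn].
- have touch := nice_touch A R (fun _ h => h) hn; split=> //.
  have gA := nice_ns_udim gR (udim_ge_touch hge touch) hn.
  split=> // st; rewrite st in hn.
    exact: (strong_nice_prime gA gR hn).
  exact: (strong_nice_semiprime gA gR hn).
- have touch c : R c -> c != 0 -> exists2 a, a * c != 0 & A (a * c).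
    move=> cR cnz; have [i Li] := Lex; have [h _] := IH i Li.
    by have [a anz aA] := h c cR cnz; exists a => //; apply/hA; exists i.
  split=> //; split.
  + apply: chain_ns_udim Lex inc hA _ (udim_ge_touch hge touch) => i Li.
    by have [_ []] := IH i Li.
  + move=> st pR a b aA bA hab.
    have [f|i Li h] := chain_seq (s := [:: a; b]) Lex inc.
      by rewrite !inE => /orP[]/eqP->; apply/hA.
    have [_ [_ hp _]] := IH i Li; apply: (hp st pR).
    * by apply: h; rewrite inE eqxx.
    * by apply: h; rewrite !inE eqxx orbT.
    * by move=> r ri; apply: hab; apply/hA; exists i.
  + move=> st pR a aA haa; have /hA[i Li ai] := aA.
    have [_ [_ _ hp]] := IH i Li; apply: (hp st pR) => // r ri.
    by apply: haa; apply/hA; exists i.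
- have touch := nice_touch A At RAt hn; split=> //.
  have touchAt c : R c -> c != 0 -> exists2 a, a * c != 0 & At (a * c).
    by move=> cR cnz; exists 1; rewrite mul1r //; apply: RAt.
  have [h1 h2 h3] := ore i.
  have [gAt hp hsp] := special_transfer (Sk_subring i) h1 h2 h3 (@Sk_free i) npos sp
    (fun m dm => let: conj _ (And3 g _ _) := IH m dm in g) (udim_ge_touch hge touchAt).
  have gA := nice_ns_udim gAt (udim_ge_touch hge touch) hn.
  split=> // st; rewrite st in hn * => pR.
    apply: (strong_nice_prime gA gAt hn); apply: hp => m dm.
    by have [_ [_ h _]] := IH m dm; apply: h; rewrite ?st.
  apply: (strong_nice_semiprime gA gAt hn); apply: hsp => m dm.
  by have [_ [_ _ h]] := IH m dm; apply: h; rewrite ?st.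
Qed.

End SkewPolynomials.

Theorem mainTheorem18 (S : nzRingType) (R : S -> Prop) (I : Type)
  (lt : I -> I -> Prop) (x : I -> S) (alpha delta : I -> S -> S)
  (A : S -> Prop) :
  skew_poly_bijective R lt x alpha delta ->
  left_goldie R -> prime_ring R \/ semiprime_ring R ->
  ess R lt x false (fun _ => True) A ->
  [/\ left_goldie A,
      (forall n, udim R n -> udim A n) &
      (ess R lt x true (fun _ => True) A ->
         (prime_ring R -> prime_ring A) /\
         (semiprime_ring R -> semiprime_ring A))].
Proof.
move=> skew [[n0 un0] accR] psp essA.
have hR : subring R by case: skew.
have spR : semiprime_ring R by case: psp => [/prime_semiprime|].
have gR n : udim R n -> (0 < n)%N /\ ns_udim n R.
  move=> /(udimP _ hR)[hge hle]; split; last first.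
    by split=> //; apply: semiprime_nonsingular.
  (* The one-element family [1] is independent, so [n] is positive. *)
  have := hle 'I_1 setT (fun=> 1); rewrite cardsT card_ord; apply.
    by move=> _ _; apply: subring1.
  split=> [i _|a _]; first exact: oner_neq0.
  rewrite (eq_bigl xpredT) => [|i]; last by rewrite inE.
  by rewrite big_ord1 => s0 i _; rewrite (ord1 i).
have gA n : udim R n -> left_goldie A /\ udim A n.
  move=> /gR[npos g]; have [gA _ _] := ess_ns_udim skew npos g essA.
  exact: ns_udim_goldie gA.
split; first by have [] := gA _ un0.
  by move=> n /gA[].
move=> essT; have [npos g] := gR _ un0.
by have [_ h1 h2] := ess_ns_udim skew npos g essT; split; [apply: h1|apply: h2].
Qed.
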